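(* Let $1/2\le\gamma<1$, and let $J$ be a Jacobi matrix with coefficient sequences $(a_n),(b_n),(c_n)$ such that $$ |2b_n|+|4a_nc_n-1|\le De^{-n^\gamma},\qquad n\ge0, $$ for some $D\ge1$. (a) If $\gamma=1/2$, then $N_J\le\exp(c\sqrt D)$ for some absolute positive constant $c$. (b) If $1/2<\gamma<1$, then $N_J\le c_\gamma D^{\gamma/(2\gamma-1)}$ for a constant $c_\gamma$ depending only on $\gamma$.
   Context: The Jacobi matrix $J$ with complex sequences $(a_n)_{n\ge0},(b_n)_{n\ge0},(c_n)_{n\ge0}$ is the tridiagonal operator on $\ell^2(\mathbb N_0)$ with matrix entries $J_{n,n}=b_n$, $J_{n,n+1}=c_n$, $J_{n+1,n}=a_n$ ($n\ge0$), all other entries zero. Standing assumptions: $a_n\to\frac12$, $c_n\to\frac12$, $b_n\to0$, and the sequences $(a_n-\frac12)$, $(b_n)$, $(c_n-\frac12)$ belong to $\ell^1$. Under these assumptions the essential spectrum of $J$ is $[-1,1]$ and the spectrum of $J$ in $\mathbb C\setminus[-1,1]$ consists of isolated eigenvalues of finite algebraic multiplicity. $N_J$ denotes the number of eigenvalues of $J$ in $\mathbb C\setminus[-1,1]$, counted with algebraic multiplicity. *)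

(* Defs.v *)
From HB Require Import structures.
From mathcomp Require Import all_boot all_order all_algebra.
From mathcomp Require Import complex.
From mathcomp Require Import all_classical all_reals all_analysis.
Set Implicit Arguments.
Unset Strict Implicit.
Unset Printing Implicit Defensive.
Import Order.TTheory GRing.Theory Num.Theory.
Import numFieldNormedType.Exports.
Local Open Scope classical_set_scope.
Local Open Scope complex_scope.
Local Open Scope ring_scope.

(* The norm `|z| of [R[i]] is [R[i]]-valued; this is the modulus as a real. *)
Notation modulus z := (ComplexField.Normc.normc z).

Definition ell1 (R : realType) (u : nat -> R[i]) : Prop :=
  cvgn (series (fun n => modulus (u n))).

Definition ell2 (R : realType) (u : nat -> R[i]) : Prop :=
  cvgn (series (fun n => modulus (u n) ^+ 2)).

Definition jacobi_entry (R : realType) (a b c : nat -> R[i]) (m n : nat)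
    : R[i] :=
  if m == n then b n
  else if n == m.+1 then c m
  else if m == n.+1 then a n
  else 0.

(* Row m has no nonzero entry beyond column m.+1, so the sum is finite.  The
   operator is written on all sequences; the entries are bounded for the
   matrices considered, so it maps ell2 to itself. *)
Definition jacobi (R : realType) (a b c : nat -> R[i]) (u : nat -> R[i])
    : nat -> R[i] :=
  fun m => \sum_(n < m.+2) jacobi_entry a b c m n * u n.

Definition jacobi_standing (R : realType) (a b c : nat -> R[i]) : Prop :=
  [/\ modulus (a n - 2^-1) @[n --> \oo] --> (0 : R),
      modulus (c n - 2^-1) @[n --> \oo] --> (0 : R),
      modulus (b n) @[n --> \oo] --> (0 : R) &
      [/\ ell1 (fun n => a n - 2^-1), ell1 b & ell1 (fun n => c n - 2^-1)]].

Definition is_eigenvalue (R : realType)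
    (T : (nat -> R[i]) -> (nat -> R[i])) (z : R[i]) : Prop :=
  exists u : nat -> R[i],
    [/\ ell2 u, exists n, u n != 0 & forall n, T u n = z * u n].

Definition root_space (R : realType)
    (T : (nat -> R[i]) -> (nat -> R[i])) (z : R[i]) : set (nat -> R[i]) :=
  [set u | ell2 u /\
    exists k : nat, forall n, iter k (fun v m => T v m - z * v m) u n = 0].

Definition lin_indep (R : realType) (d : nat) (v : 'I_d -> nat -> R[i])
    : Prop :=
  forall k : 'I_d -> R[i],
    (forall n, \sum_(i < d) k i * v i n = 0) -> forall i, k i = 0.

Definition seq_dim (R : realType) (V : set (nat -> R[i])) : \bar R :=
  ereal_sup [set (d%:R)%:E | d in
    [set d : nat | exists v : 'I_d -> nat -> R[i],
      (forall i, V (v i)) /\ lin_indep v]].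

Definition alg_mult (R : realType)
    (T : (nat -> R[i]) -> (nat -> R[i])) (z : R[i]) : \bar R :=
  seq_dim (root_space T z).

Definition cut (R : realType) : set R[i] :=
  [set x%:C | x in [set x : R | -1 <= x <= 1]].

Definition N_jacobi (R : realType) (a b c : nat -> R[i]) : \bar R :=
  \esum_(z in [set z | is_eigenvalue (jacobi a b c) z /\ ~ cut z])
     alg_mult (jacobi a b c) z.

Definition stretched_exp_bound (R : realType) (gamma D : R)
    (a b c : nat -> R[i]) : Prop :=
  forall n : nat,
    modulus (2 * b n) + modulus (4 * a n * c n - 1)
      <= D * expR (- (n%:R `^ gamma)).

(* Main.v *)
(** A point [z] outside [-1, 1] is written [z = (w + 1/w)/2] with [|w| < 1].  The
    polynomials [q_m(w) = (2w)^m det (z - J_m)] and [f_m = q_m - w^2 q_(m-1)]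
    satisfy a recursion perturbing the free one; hence [f_m(0) = 1], and the
    coefficients of [f_m] are at most [A exp (- n^gamma / 4)], uniformly in [m],
    with [ln A = K D^s] for an exponent [s > 0] that can be chosen as small as
    wanted.  If [c_n] never vanishes, then the root vectors of [J], which tend to
    [0], force [f_m] to be arbitrarily close, for large [m], to a multiple of
    [prod (w - w_i)], with one factor for each eigenvalue counted with
    multiplicity; otherwise [J] decouples, and the finite block it starts with
    has size [O((ln D)^2)].

    It remains to count the zeros in the disc of a polynomial [p] with
    [|p(0)| >= 1/2] and coefficients at most [A exp (- n^gamma / 4)].  If there
    are [2 * 16^J] of them, then either Jensen's inequality bounds [J], or half of
    them have modulus at least [1 - 2^-J].  In that case nested squares give a
    point [zeta] of the circle with at least [b^j] zeros at distance [O(2^-j)],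
    for all [j <= J], where [b = 2^(gamma/(1 - gamma))]; so [|p|] is at most
    [A exp (- c b^j)] at distance [2^-j] of [zeta].  The maximum principle for the
    product of [p] with a function that has poles of order about [b^j] at
    [(1 + 2^-j) zeta] yields [sum_(j <= J) (b/2)^j <= K (1 + ln A)].  For
    [gamma = 1/2] the left-hand side is [J + 1], and [s = 1/2] gives (a); for
    [gamma > 1/2] it grows geometrically, and a small [s] gives (b), even with
    the exponent [1] of [D]. *)
Require Import Defs.
From HB Require Import structures.
From mathcomp Require Import all_boot all_order all_algebra.
From mathcomp Require Import complex.
From mathcomp Require Import all_classical all_reals all_analysis.
From mathcomp Require Import cyclic separable cyclotomic.
From mathcomp Require Import ring lra zify.
Import Order.TTheory GRing.Theory Num.Theory.
Import numFieldNormedType.Exports.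
Local Open Scope classical_set_scope.
Local Open Scope complex_scope.
Local Open Scope ring_scope.
Set Implicit Arguments.
Unset Strict Implicit.
Unset Printing Implicit Defensive.

(** * The maximum principle for polynomials *)

Section Modulus.
Variable R : realType.
Implicit Types z w : R[i].

Lemma normr_modulus z : `|z| = (modulus z)%:C.
Proof. by case: z. Qed.

Lemma modulus_real (x : R) : modulus x%:C = `|x|.
Proof. by rewrite /= expr0n addr0 sqrtr_sqr. Qed.

Lemma modulus_ge0 z : 0 <= modulus z.
Proof. by case: z => x y; exact: sqrtr_ge0. Qed.

Lemma modulusD z w : modulus (z + w) <= modulus z + modulus w.
Proof. exact: le_normcD. Qed.

Lemma modulusN z : modulus (- z) = modulus z.
Proof. exact: normcN. Qed.

Lemma modulusB z w : modulus (z - w) = modulus (w - z).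
Proof. by rewrite -modulusN opprB. Qed.

Lemma modulusM z w : modulus (z * w) = modulus z * modulus w.
Proof. exact: ComplexField.Normc.normcM. Qed.

Lemma modulus0 : modulus (0 : R[i]) = 0.
Proof. exact: ComplexField.Normc.normc0. Qed.

Lemma modulus1 : modulus (1 : R[i]) = 1.
Proof. exact: ComplexField.Normc.normc1. Qed.

Lemma modulus_eq0 z : (modulus z == 0) = (z == 0).
Proof.
apply/eqP/eqP => [/ComplexField.Normc.eq0_normc //|->]; exact: modulus0.
Qed.

Lemma modulus_gt0 z : (0 < modulus z) = (z != 0).
Proof. by rewrite lt0r modulus_ge0 andbT modulus_eq0. Qed.

Lemma modulusX z n : modulus (z ^+ n) = modulus z ^+ n.
Proof.
by elim: n => [|n IHn]; rewrite ?expr0 ?modulus1 // !exprS modulusM IHn.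
Qed.

Lemma modulusV z : modulus z^-1 = (modulus z)^-1.
Proof. exact: ComplexField.Normc.normcV. Qed.

Lemma modulus_conj z : modulus z^*%C = modulus z.
Proof. by case: z => x y /=; rewrite sqrrN. Qed.

Lemma modulus_nat n : modulus (n%:R : R[i]) = n%:R.
Proof.
by rewrite -(rmorph_nat (real_complex R)) modulus_real ger0_norm ?ler0n.
Qed.

Lemma modulus_mulconj z : z * z^*%C = (modulus z ^+ 2)%:C.
Proof. by rewrite -sqr_normc normr_modulus rmorphXn. Qed.

Lemma modulus_sum (I : Type) (r : seq I) (P : pred I) (F : I -> R[i]) :
  modulus (\sum_(i <- r | P i) F i) <= \sum_(i <- r | P i) modulus (F i).
Proof.
elim/big_rec2: _ => [|i y x _ le_xy]; first by rewrite modulus0.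
by rewrite (le_trans (modulusD _ _)) // lerD2l.
Qed.

Lemma modulus_prod (I : Type) (r : seq I) (P : pred I) (F : I -> R[i]) :
  modulus (\prod_(i <- r | P i) F i) = \prod_(i <- r | P i) modulus (F i).
Proof. by apply: (big_morph _ modulusM modulus1). Qed.

Lemma le_modulusB z w : modulus z - modulus w <= modulus (z - w).
Proof. by rewrite lerBlDr (le_trans _ (modulusD _ _)) // subrK. Qed.

Lemma modulus_rect (x y : R) : modulus (x +i* y) <= `|x| + `|y|.
Proof.
rewrite /= -[leRHS]ger0_norm ?addr_ge0 // -sqrtr_sqr ler_wsqrtr //.
by rewrite sqrrD !real_normK ?num_real // -addrA lerD2l lerDr mulrn_wge0 ?mulr_ge0.
Qed.

Lemma le_Re_modulus z : `|complex.Re z| <= modulus z.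
Proof.
by case: z => x y /=; rewrite -sqrtr_sqr ler_wsqrtr // lerDl sqr_ge0.
Qed.

Lemma le_Im_modulus z : `|complex.Im z| <= modulus z.
Proof.
by case: z => x y /=; rewrite -sqrtr_sqr ler_wsqrtr // lerDr sqr_ge0.
Qed.

End Modulus.

Section MaximumPrinciple.
Variable R : realType.
Implicit Types (p g : {poly R[i]}) (M : R).

Lemma primitive_root_exists n : (0 < n)%N ->
  exists z : R[i], n.-primitive_root z.
Proof.
move=> n_gt0; pose p : {poly R[i]} := 'X^n - 1.
have [r Dp] := closed_field_poly_normal p.
rewrite (monicP _) ?monicXnsubC // scale1r in Dp.
have rn1 : all n.-unity_root r by apply/allP=> z; rewrite -root_prod_XsubC -Dp.
have sz_r : (n < (size r).+1)%N.
  by rewrite -(size_prod_XsubC r id) -Dp size_XnsubC.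
have [|z] := hasP (has_prim_root n_gt0 rn1 _ sz_r); last by exists z.
by rewrite -separable_prod_XsubC -Dp separable_Xn_sub_1 // pnatr_eq0 -lt0n.
Qed.

(** [z ^+ k] is an [n]-th root of unity other than 1, so it annihilates [1 + X + ... + X^(n-1)]. *)
Lemma sum_primitive_root n (z : R[i]) k : n.-primitive_root z -> (0 < k < n)%N ->
  \sum_(i < n) (z ^+ i) ^+ k = 0.
Proof.
move=> zn /andP[k_gt0 k_lt].
have zk1 : z ^+ k != 1.
  by rewrite -(prim_order_dvd zn) gtnNdvd.
apply: (mulfI (_ : z ^+ k - 1 != 0)); first by rewrite subr_eq0.
rewrite mulr0 (eq_bigr (fun i : 'I_n => (z ^+ k) ^+ i)).
  by rewrite -subrX1 exprAC (prim_expr_order zn) expr1n subrr.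
by move=> i _; rewrite exprAC.
Qed.

(* Averaging over the [n]-th roots of unity, [n] larger than the degree, kills
   every coefficient but the constant one. *)
Lemma max_principle p M :
  (forall w, modulus w = 1 -> modulus p.[w] <= M) -> modulus p`_0 <= M.
Proof.
move=> hp; pose n := (size p).+1.
have [z zn] := @primitive_root_exists n isT.
have z1 i : modulus (z ^+ i) = 1.
  suff -> : modulus (z ^+ i) = modulus z ^+ i.
    have /eqP : modulus z ^+ n = 1 ^+ n.
      by rewrite -modulusX (prim_expr_order zn) modulus1 expr1n.
    by rewrite eqrXn2 ?modulus_ge0 // => /eqP ->; rewrite expr1n.
  exact: modulusX.
have avg : \sum_(i < n) p.[z ^+ i] = n%:R * p`_0.
  rewrite (eq_bigr (fun i : 'I_n => \sum_(k < n) p`_k * (z ^+ i) ^+ k)); last first.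
    by move=> i _; rewrite (@horner_coef_wide _ n).
  rewrite exchange_big /= big_ord_recl [X in _ + X]big1 ?addr0.
    by rewrite -mulr_sumr sumr_const card_ord mulrC.
  move=> k _; rewrite -mulr_sumr sum_primitive_root ?mulr0 //=.
  by rewrite /bump leq0n add1n ltnS ltn_ord.
have n0 : 0 < n%:R :> R by rewrite ltr0n.
rewrite -(ler_pM2l n0) -[X in X * modulus _](modulus_nat R n) -modulusM -avg.
apply: le_trans (modulus_sum _ _ _) _.
have -> : n%:R * M = \sum_(i < n) M by rewrite sumr_const card_ord mulr_natl.
by apply: ler_sum => i _; exact: hp.
Qed.

(* Each factor [X - x] is replaced by [1 - x^* X], which has the same modulus
   on the unit circle. *)
Lemma jensen_bound (s : seq R[i]) g M :
  (forall w, modulus w = 1 ->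
     modulus (\prod_(x <- s) ('X - x%:P) * g).[w] <= M) ->
  modulus (\prod_(x <- s) ('X - x%:P) * g)`_0 <= M * \prod_(x <- s) modulus x.
Proof.
move=> hs.
rewrite -horner_coef0 hornerM horner_prod modulusM modulus_prod mulrC.
rewrite (eq_bigr (fun x => modulus x)) => [|x _]; last by rewrite hornerXsubC sub0r modulusN.
apply: ler_wpM2r; first by apply: prodr_ge0 => x _; exact: modulus_ge0.
suff -> : g.[0] = (\prod_(x <- s) (1 - x^*%C *: 'X) * g)`_0.
  apply: max_principle => w w1; apply: le_trans (hs w w1).
  rewrite !hornerM !horner_prod !modulusM ler_wpM2r ?modulus_ge0 //.
  rewrite !modulus_prod le_eqVlt; apply/orP; left; apply/eqP/eq_bigr => x _.
  rewrite hornerXsubC !hornerE -[LHS]mul1r -[X in X * _]w1 -(modulus_conj w).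
  rewrite -modulusM mulrBr mulr1 mulrCA [w^*%C * _]mulrC modulus_mulconj w1.
  by rewrite expr1n mulr1 -rmorphB modulus_conj.
rewrite -horner_coef0 hornerM horner_prod big1 ?mul1r // => x _.
by rewrite !hornerE /= ?mulr0 ?subr0.
Qed.

(* This holds for every limit of polynomials of modulus [om] on the circle and
   [c] at the origin: they serve as multipliers of [p]. *)
Definition weight_admissible (om : R[i] -> R) (c : R) :=
  forall p M, (forall w, modulus w = 1 -> modulus p.[w] * om w <= M) ->
    modulus p`_0 * c <= M.

Lemma weight_admissible1 : weight_admissible (fun=> 1) 1.
Proof.
by move=> p M hp; rewrite mulr1; apply: max_principle => w /hp; rewrite mulr1.
Qed.

End MaximumPrinciple.

(** * Weights with poles just outside the unit circle *)

Section PoleWeight.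
Variable R : realType.
Implicit Types (p : {poly R[i]}) (w z : R[i]).

Lemma sqr_modulus z : modulus z ^+ 2 = complex.Re z ^+ 2 + complex.Im z ^+ 2.
Proof. by case: z => x y /=; rewrite sqr_sqrtr ?addr_ge0 ?sqr_ge0. Qed.

(** Law of cosines; it turns the distances from [1 + r] and [1 + 2 r] to a point [s] of the circle
    into functions of [modulus (s - 1)] alone. *)
Lemma sqr_modulus_circle (a : R) (s : R[i]) : modulus s = 1 ->
  modulus (a%:C - s) ^+ 2 = (a - 1) ^+ 2 + a * modulus (s - 1) ^+ 2.
Proof.
move=> s1; have : modulus s ^+ 2 = 1 by rewrite s1 expr1n.
rewrite !sqr_modulus; case: s {s1} => x y /=; rewrite !sub0r !sqrrN subr0 => h.
have -> : y ^+ 2 = 1 - x ^+ 2 by rewrite -h addrC addKr.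
ring.
Qed.

(** With [t = modulus (s - 1)], this compares the squared distances from [s] to [1 + 2 r] and to
    [1 + r]. With [x] the argument of [expR], [1 + x <= expR x] suffices, because
    [k * (1 + r) = 1 + 2 * r] already accounts for the [t ^+ 2] term. *)
Lemma sqr_ratio_le (r t : R) : 0 < r ->
  4 * r ^+ 2 + (1 + 2 * r) * t ^+ 2 <=
  (1 + 2 * r) / (1 + r) * expR (8 * r ^+ 2 / (r ^+ 2 + t ^+ 2)) *
  (r ^+ 2 + (1 + r) * t ^+ 2).
Proof.
move=> r0; have r20 : 0 < r ^+ 2 by rewrite exprn_gt0.
have t20 : 0 <= t ^+ 2 by exact: sqr_ge0.
have d0 : 0 < r ^+ 2 + t ^+ 2 by rewrite ltr_pwDl.
set k := (1 + 2 * r) / (1 + r).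
have k1 : 1 <= k by rewrite ler_pdivlMr; lra.
have kE : k * (1 + r) = 1 + 2 * r by rewrite /k divfK //; lra.
set x := 8 * r ^+ 2 / (r ^+ 2 + t ^+ 2).
have xE : x * (r ^+ 2 + t ^+ 2) = 8 * r ^+ 2 by rewrite /x divfK ?gt_eqF.
have x0 : 0 <= x by rewrite /x divr_ge0 ?mulr_ge0 // ltW.
have ex : 1 + x <= expR x by exact: expR_ge1Dx.
have s0 : 0 <= r ^+ 2 + (1 + r) * t ^+ 2 by apply: addr_ge0;
  [exact: ltW | apply: mulr_ge0 => //; lra].
apply: (@le_trans _ _ (k * (1 + x) * (r ^+ 2 + (1 + r) * t ^+ 2))); last first.
  by rewrite ler_wpM2r // ler_wpM2l //; lra.
have h1 : 8 * r ^+ 2 <= k * x * (r ^+ 2 + (1 + r) * t ^+ 2).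
  rewrite -xE; have ds : r ^+ 2 + t ^+ 2 <= r ^+ 2 + (1 + r) * t ^+ 2.
    by rewrite lerD2l ler_peMl //; lra.
  by apply: le_trans (ler_wpM2l x0 ds) _; rewrite -mulrA ler_peMl // mulr_ge0.
have -> : k * (1 + x) * (r ^+ 2 + (1 + r) * t ^+ 2) =
  k * r ^+ 2 + k * (1 + r) * t ^+ 2 + k * x * (r ^+ 2 + (1 + r) * t ^+ 2).
  by ring.
rewrite kE; have : 0 <= k * r ^+ 2 by rewrite mulr_ge0 ?(ltW r20) //; lra.
lra.
Qed.

(** This is the net gain at the origin from one pole. Since [expR (r / 4) * (1 - r / 4) <= 1], it
    reduces to [1 + r <= (1 + 2 r) (1 - r / 4)]. *)
Lemma expR_le_sqrt_ratio (r : R) : 0 < r <= 1 ->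
  expR (r / 8) <= Num.sqrt ((1 + 2 * r) / (1 + r)).
Proof.
move=> /andP[r0 r1].
have k0 : 0 <= (1 + 2 * r) / (1 + r) by rewrite divr_ge0; lra.
rewrite -[leLHS]ger0_norm ?expR_ge0 // -sqrtr_sqr ler_wsqrtr //.
rewrite -expRM_natl (_ : 2 * (r / 8) = r / 4); last by field.
have h : 1 - r / 4 <= expR (- (r / 4)) by rewrite -[leLHS]opprK opprB;
  have := expR_ge1Dx (- (r/4)); lra.
have ep := expR_gt0 (r / 4); have eN : expR (r / 4) * expR (- (r / 4)) = 1.
  by rewrite expRN divff // gt_eqF.
have h2 : expR (r / 4) * (1 - r / 4) <= 1 by rewrite -[leRHS]eN ler_wpM2l // ltW.
rewrite ler_pdivlMr; last lra.
have h3 : 1 + r <= (1 + 2 * r) * (1 - r / 4) by nra.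
apply: le_trans (ler_wpM2l (ltW ep) h3) _.
by rewrite mulrCA -[leRHS]mulr1 ler_wpM2l //; lra.
Qed.

(* A truncated geometric series for [(1 + 2 r - s) / (1 + r - s)], where
   [s = zeta^* w]. *)
Lemma pole_approximant (r : R) (zeta : R[i]) (L : nat) : 0 < r -> modulus zeta = 1 ->
  exists E : {poly R[i]}, E`_0 = ((1 + 2 * r) / (1 + r))%:C /\
    forall w, modulus w = 1 ->
      modulus E.[w] <= (1 + (1 + r) ^- L.+1) *
        (Num.sqrt ((1 + 2 * r) / (1 + r)) *
          expR (4 * r ^+ 2 / (r ^+ 2 + modulus (w - zeta) ^+ 2))).
Proof.
move=> r0 z1; set q := (1 + r)^-1.
have q0 : 0 < q by rewrite invr_gt0; lra.
pose S : {poly R[i]} := zeta^*%C *: 'X.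
exists (((1 + 2 * r)%:C%:P - S) * q%:C%:P * \sum_(l < L.+1) (q%:C *: S) ^+ l).
split.
  rewrite -horner_coef0 !hornerM horner_sum big_ord_recl big1 => [|i _].
    by rewrite !hornerE /= ?mulr0 ?subr0 ?expr0 ?addr0 ?mulr1 -rmorphM.
  by rewrite horner_exp !hornerE /= ?mulr0 expr0n.
move=> w w1; pose s := zeta^*%C * w.
have s1 : modulus s = 1 by rewrite /s modulusM modulus_conj z1 w1 mulr1.
have -> : modulus (w - zeta) = modulus (s - 1).
  rewrite -[LHS]mul1r -[X in X * _]z1 -modulus_conj -modulusM mulrBr.
  by rewrite [zeta^*%C * zeta]mulrC modulus_mulconj z1 expr1n.
set t := modulus (s - 1).
rewrite !hornerM horner_sum.
have -> : ((1 + 2 * r)%:C%:P - S).[w] = (1 + 2 * r)%:C - s by rewrite !hornerE.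
rewrite hornerC.
have -> : \sum_(l < L.+1) ((q%:C *: S) ^+ l).[w] = \sum_(l < L.+1) (q%:C * s) ^+ l.
  by apply: eq_bigr => l _; rewrite horner_exp !hornerE.
set T := \sum_(l < _) _.
(* [T] is a geometric sum of ratio [s / (1 + r)], so this product telescopes. *)
have TE : ((1 + r)%:C - s) * (q%:C * T) = 1 - (q%:C * s) ^+ L.+1.
  rewrite mulrA mulrBl -rmorphM /q divff; last lra.
  by rewrite -[LHS]opprK -mulNr opprB [s * _]mulrC -subrX1 opprB.
have d0 : 0 < modulus ((1 + r)%:C - s).
  apply: lt_le_trans (le_modulusB _ _); rewrite modulus_real s1.
  by rewrite ger0_norm; lra.
rewrite -(ler_pM2l d0) -modulusM -mulrA mulrCA TE modulusM.
rewrite mulrC [leRHS]mulrCA; apply: ler_pM; rewrite ?modulus_ge0 //.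
  rewrite (le_trans (modulusD _ _)) // modulus1 lerD2l modulusN modulusX modulusM s1 mulr1.
  by rewrite modulus_real ger0_norm ?(ltW q0) // /q exprVn.
have k0 : 0 <= (1 + 2 * r) / (1 + r) by rewrite divr_ge0; lra.
rewrite -[leLHS]ger0_norm ?modulus_ge0 // -sqrtr_sqr.
rewrite -[leRHS]ger0_norm ?mulr_ge0 ?modulus_ge0 ?expR_ge0 ?sqrtr_ge0 //.
rewrite -sqrtr_sqr ler_wsqrtr // !exprMn sqr_sqrtr // -expRM_natl.
rewrite !sqr_modulus_circle // -/t.
have -> : (1 + 2 * r - 1) ^+ 2 = 4 * r ^+ 2 by ring.
have -> : (1 + r - 1) ^+ 2 = r ^+ 2 by ring.
have -> : 2%:R * (4 * r ^+ 2 / (r ^+ 2 + t ^+ 2)) = 8 * r ^+ 2 / (r ^+ 2 + t ^+ 2).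
  by rewrite !mulrA -natrM.
by rewrite [leRHS]mulrC; exact: sqr_ratio_le.
Qed.

(** Apply the admissibility of [om] to [p * E], with [E] the approximant. On the circle [E] costs
    [sqrt k] times the new weight, up to a factor tending to 1; at the origin it equals [k]. The
    surplus [sqrt k] is at least [expR (r / 8)]. *)
Lemma weight_admissible_pole (om : R[i] -> R) c (r : R) (zeta : R[i]) :
  0 < r <= 1 -> modulus zeta = 1 -> (forall w, 0 <= om w) -> 0 <= c ->
  weight_admissible om c ->
  weight_admissible
    (fun w => om w * expR (4 * r ^+ 2 / (r ^+ 2 + modulus (w - zeta) ^+ 2)))
    (c * expR (r / 8)).
Proof.
move=> /andP[r0 r1] z1 om0 c0 adm p M hp.
set k := (1 + 2 * r) / (1 + r).
have k0 : 0 < k by rewrite /k divr_gt0; lra.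
have sk0 : 0 < Num.sqrt k by rewrite sqrtr_gt0.
have M0 : 0 <= M.
  apply: le_trans (hp 1 (modulus1 R)).
  by rewrite mulr_ge0 ?modulus_ge0 // mulr_ge0 ?expR_ge0.
have cvg L : modulus p`_0 * c * Num.sqrt k <= (1 + (1 + r) ^- L.+1) * M.
  have [E [E0 hE]] := pole_approximant L r0 z1.
  have hL : 0 <= 1 + (1 + r) ^- L.+1.
    by rewrite addr_ge0 // invr_ge0 exprn_ge0 //; lra.
  have := adm (p * E) ((1 + (1 + r) ^- L.+1) * (Num.sqrt k * M)).
  rewrite coef0M E0 modulusM modulus_real ger0_norm ?(ltW k0) //.
  move=> h; rewrite -(ler_pM2r sk0).
  have -> : modulus p`_0 * c * Num.sqrt k * Num.sqrt k = modulus p`_0 * k * c.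
    by rewrite -mulrA -expr2 sqr_sqrtr ?(ltW k0) // mulrAC.
  rewrite -[leRHS]mulrA [M * _]mulrC; apply: h => w w1.
  rewrite hornerM modulusM mulrAC.
  apply: le_trans (ler_wpM2l _ (hE w w1)) _; first by rewrite mulr_ge0 ?modulus_ge0.
  rewrite mulrCA ler_wpM2l // mulrCA ler_wpM2l ?(ltW sk0) //.
  by rewrite -mulrA; exact: hp.
have : modulus p`_0 * c * Num.sqrt k <= M.
  rewrite leNgt; apply/negP => ltM.
  have : 0 < modulus p`_0 * c * Num.sqrt k - M by rewrite subr_gt0.
  set d := _ - M => d0.
  have [L hL] : exists L : nat, M / (d * r) < L%:R.
    by exists (Num.bound (M / (d * r))); rewrite archi_boundP // divr_ge0 // mulr_ge0 // ltW.
  have := cvg L; have : (1 + r) ^- L.+1 * M < d; last by rewrite /d; lra.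
  rewrite ltr_pdivrMl ?exprn_gt0; try lra.
  (* A Bernoulli estimate, which makes the truncation error smaller than the assumed excess [d]. *)
  have hb : L%:R * r <= (1 + r) ^+ L.+1.
    apply: (@le_trans _ _ ((1 + r) ^+ L)); last first.
      by rewrite exprS ler_peMl ?exprn_ge0; lra.
    elim: (L) => [|n IHn]; first by rewrite mul0r expr0.
    rewrite exprS mulrDl mul1r -natr1 mulrDl mul1r lerD //.
    by rewrite ler_peMr ?(ltW r0) // exprn_ege1 //; lra.
  have dr : 0 < d * r by rewrite mulr_gt0.
  move: hL; rewrite ltr_pdivrMr // => /lt_le_trans; apply.
  by rewrite mulrCA mulrC ler_wpM2r // ltW.
move=> /(le_trans _); apply; rewrite mulrA ler_wpM2l ?mulr_ge0 ?modulus_ge0 //.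
by apply: expR_le_sqrt_ratio; rewrite r0.
Qed.

Lemma weight_admissible_poles (zeta : R[i]) J (r : nat -> R) (m : nat -> nat) :
  modulus zeta = 1 -> (forall j, 0 < r j <= 1) ->
  weight_admissible
    (fun w => expR (\sum_(j < J) (m j)%:R *
                      (4 * r j ^+ 2 / (r j ^+ 2 + modulus (w - zeta) ^+ 2))))
    (expR (\sum_(j < J) (m j)%:R * (r j / 8))).
Proof.
move=> z1 hr.
pose om (F : R -> R[i] -> R) J w := expR (\sum_(j < J) (m j)%:R * F (r j) w).
suff adm : weight_admissible
    (om (fun r w => 4 * r ^+ 2 / (r ^+ 2 + modulus (w - zeta) ^+ 2)) J)
    (om (fun r w => r / 8) J 0) by [].
elim: J => [|J IHJ] p M.
  rewrite /om big_ord0 expR0 => hp; apply: weight_admissible1 => w w1.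
  by have := hp w w1; rewrite big_ord0 expR0.
pose F := fun (r : R) w => 4 * r ^+ 2 / (r ^+ 2 + modulus (w - zeta) ^+ 2).
pose c := om (fun r w => r / 8) J 0.
(* The [m J] poles of radius [r J] are added one at a time. *)
have : forall k : nat, weight_admissible (fun w => om F J w * expR (k%:R * F (r J) w))
      (c * expR (k%:R * (r J / 8))).
  elim=> [|k IHk] p' M'.
    rewrite mul0r expR0 mulr1 => hp; apply: IHJ => w w1.
    by have := hp w w1; rewrite mul0r expR0 mulr1.
  have := @weight_admissible_pole _ _ (r J) zeta (hr J) z1 _ _ IHk p' M'.
  have nat1 (a : R) : k%:R * a + a = k.+1%:R * a by rewrite -natr1 mulrDl mul1r.
  move=> h hp; rewrite -(nat1 (r J / 8)) expRD mulrA.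
  apply: h => [w||w w1]; try by rewrite mulr_ge0 ?expR_ge0.
  by have := hp w w1; rewrite -(nat1 (F (r J) w)) expRD !mulrA.
move=> /(_ (m J) p M) h hp; move: h;
  rewrite /c /om -expRD -(big_ord_recr J (fun j => (m j)%:R * (r j / 8))).
apply=> w w1; have := hp w w1.
by rewrite /om big_ord_recr /= expRD.
Qed.

End PoleWeight.

(** * Smallness near clustered zeros *)

Section Division.
Variable R : realType.
Implicit Types (p g : {poly R[i]}) (x w : R[i]).

(* From [p_n = g_(n-1) - x g_n] and Pascal's rule, by Abel summation. *)
Lemma division_coef_bound1 g x l L : modulus x <= 1 -> (size g < L)%N ->
  \sum_(n < L) modulus g`_n * 'C(n, l)%:R <=
  \sum_(n < L) modulus (('X - x%:P) * g)`_n * 'C(n, l.+1)%:R.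
Proof.
case: L => // L x1; rewrite ltnS => gL.
pose u n : R := modulus g`_n.
have gn : u L = 0 by rewrite /u nth_default ?modulus0.
have step n : u n * 'C(n, l)%:R =
    u n * 'C(n.+1, l.+1)%:R - u n * 'C(n, l.+1)%:R.
  by rewrite binS natrD mulrDr addrC addKr.
have pE n : (('X - x%:P) * g)`_n.+1 = g`_n - x * g`_n.+1.
  by rewrite mulrBl coefB coefXM /= coefCM.
under eq_bigr do rewrite step.
rewrite sumrB big_ord_recr /= -/(u L) gn mul0r addr0.
rewrite [X in _ - X]big_ord_recl [leRHS]big_ord_recl !bin0n /= !mulr0 !add0r.
rewrite lerBlDr -big_split /= ; apply: ler_sum => i _.
rewrite /bump leq0n add1n -mulrDl ler_wpM2r ?ler0n // pE /u.
apply: le_trans (le_trans _ (modulusD (g`_i - x * g`_i.+1) (x * g`_i.+1))) _.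
  by rewrite subrK.
by rewrite lerD2l modulusM ler_piMl ?modulus_ge0.
Qed.

(** Each root that is divided out raises the lower index of the binomial weight by one. *)
Lemma division_coef_bound g (s : seq R[i]) l L : all (fun x => modulus x <= 1) s ->
  (size g + size s < L)%N ->
  \sum_(n < L) modulus g`_n * 'C(n, l)%:R <=
  \sum_(n < L) modulus (\prod_(x <- s) ('X - x%:P) * g)`_n * 'C(n, l + size s)%:R.
Proof.
elim: s g l => [|x s IHs] g l /=.
  by move=> _ _; rewrite big_nil mul1r addn0.
move=> /andP[x1 s1] gL; rewrite addnS big_cons -mulrA.
have gL' : (size g + size s < L)%N by move: gL; rewrite addnS; exact: ltnW.
apply: le_trans (IHs g l s1 gL') _.
apply: division_coef_bound1 => //; apply: leq_ltn_trans (size_polyMleq _ _) _.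
by rewrite size_prod_XsubC addSn addnC.
Qed.

(** The removed factors contribute at most [rho] each at [w]; the quotient is at most the sum of its
    coefficients in modulus, which is [division_coef_bound] at [l = 0]. *)
Lemma division_horner_bound g (s : seq R[i]) (p : {poly R[i]}) (rho : R) w :
  p = \prod_(x <- s) ('X - x%:P) * g ->
  all (fun x => modulus x <= 1) s -> modulus w <= 1 ->
  all (fun x => modulus (w - x) <= rho) s ->
  exists L, modulus p.[w] <=
    rho ^+ size s * \sum_(n < L) modulus p`_n * 'C(n, size s)%:R.
Proof.
move=> pE s1 w1 sr; exists (size g + size s).+1.
rewrite {1}pE hornerM modulusM horner_prod modulus_prod; apply: ler_pM.
- by apply: prodr_ge0 => x _; exact: modulus_ge0.
- exact: modulus_ge0.
- have -> : rho ^+ size s = \prod_(x <- s) rho.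
    by rewrite big_const_seq count_predT iter_mulr mulr1.
  rewrite big_seq [leRHS]big_seq; apply: ler_prod => x xs.
  by rewrite hornerXsubC modulus_ge0 (allP sr).
have := @division_coef_bound g s 0 (size g + size s).+1 s1 (ltnSn _).
rewrite -pE add0n => /(le_trans _); apply.
rewrite (@horner_coef_wide _ (size g + size s).+1); last first.
  by rewrite leqW // leq_addr.
apply: le_trans (modulus_sum _ _ _) _; apply: ler_sum => n _.
by rewrite bin0 mulr1 modulusM modulusX ler_piMr ?modulus_ge0 ?exprn_ile1 ?modulus_ge0.
Qed.

End Division.

(** * Binomial weights against stretched exponentials *)

Section BinomialDecay.
Variable R : realType.
Implicit Types (x y g rho : R).

Lemma bin_expR_le n k x : 0 <= x -> 'C(n, k)%:R * x ^+ k <= expR (n%:R * x).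
Proof.
move=> x0; apply: (@le_trans _ _ ((1 + x) ^+ n)); last first.
  by rewrite expRM_natl lerXn2r ?nnegrE ?expR_ge0 ?addr_ge0 // expR_ge1Dx.
have [kn|nk] := leqP k n; last by rewrite bin_small ?mul0r // exprn_ge0 // addr_ge0.
rewrite exprDn (bigD1 (Ordinal (kn : (k < n.+1)%N))) //= expr1n mul1r mulr_natl.
rewrite lerDl sumr_ge0 // => i _.
by rewrite mulrn_wge0 // expr1n mul1r exprn_ge0.
Qed.

(** The left-hand side is [g^-1 * ln ((e^2 y)^g)], and [ln u <= u]. *)
Lemma ln_sqr_le_powR y g : 0 < y -> 2^-1 <= g <= 1 ->
  2 + ln y <= 2 * expR 2 * y `^ g.
Proof.
move=> y0 /andP[g0 g1].
have gp : 0 < g by lra.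
have ey0 : 0 < expR 2 * y by rewrite mulr_gt0 ?expR_gt0.
have -> : 2 + ln y = g^-1 * ln ((expR 2 * y) `^ g).
  rewrite ln_powR mulrA mulVf ?gt_eqF // mul1r lnM ?posrE ?expR_gt0 //.
  by rewrite expRK.
have h : ln ((expR 2 * y) `^ g) <= (expR 2 * y) `^ g.
  set u := _ `^ g; have u0 : 0 < u by exact: powR_gt0.
  have := @le_ln1Dx R (u - 1); rewrite [1 + _]addrC subrK => h.
  by apply: le_trans (h _) _; lra.
have h2 : (expR 2 * y) `^ g <= expR 2 * y `^ g.
  rewrite powRM ?expR_ge0 ?(ltW y0) // ler_wpM2r ?powR_ge0 //.
  rewrite -[leRHS]powRr1 ?expR_ge0 // ler_powR //.
  by have := expR_ge1Dx (2 : R); lra.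
have h3 : g^-1 <= 2.
  by rewrite invf_ple ?posrE.
apply: (@le_trans _ _ (2 * (expR 2 * y `^ g))); last by rewrite mulrA.
apply: (@le_trans _ _ (g^-1 * (expR 2 * y `^ g))).
  by rewrite ler_wpM2l ?invr_ge0 ?(ltW gp) // (le_trans h).
by rewrite ler_wpM2r // mulr_ge0 ?expR_ge0 ?powR_ge0.
Qed.

(** Put [y = n rho / k]. From ['C(n, k) (k / n)^k <= e^k], the left-hand side is at most
    [exp (- k + k (2 + ln y))], and [ln_sqr_le_powR] bounds [k (2 + ln y)] by
    [2 e^2 k^(1-g) (n rho)^g], which the hypothesis makes at most [n^g / 8]. *)
Lemma bin_decay n k rho g : 0 < rho -> 2^-1 <= g <= 1 ->
  16 * expR 2 * (k%:R `^ (1 - g)) * rho `^ g <= 1 ->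
  'C(n, k)%:R * rho ^+ k <= expR (- k%:R) * expR (n%:R `^ g / 8).
Proof.
move=> r0 g01 hk.
case: k hk => [|k] hk.
  by rewrite bin0 expr0 mulr1 oppr0 expR0 mul1r -expR0 ler_expR divr_ge0 ?powR_ge0.
have [nk|kn] := ltnP n k.+1; first by rewrite bin_small // mul0r mulr_ge0 ?expR_ge0.
case: n kn => // n kn.
set K : R := k.+1%:R; set N : R := n.+1%:R.
have K0 : 0 < K by rewrite ltr0n.
have N0 : 0 < N by rewrite ltr0n.
have x0 : 0 < K / N by rewrite divr_gt0.
pose y := N * rho / K; have y0 : 0 < y by rewrite divr_gt0 ?mulr_gt0.
have -> : rho ^+ k.+1 = (K / N) ^+ k.+1 * y ^+ k.+1.
  by rewrite -exprMn /y; congr (_ ^+ _); field; rewrite !gt_eqF.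
rewrite mulrA; apply: (@le_trans _ _ (expR K * y ^+ k.+1)).
  rewrite ler_wpM2r ?exprn_ge0 ?(ltW y0) //.
  apply: le_trans (bin_expR_le _ _ (ltW x0)) _.
  by rewrite -/N mulrCA divff ?gt_eqF // mulr1.
have -> : y ^+ k.+1 = expR (K * ln y) by rewrite expRM_natl lnK.
rewrite -!expRD ler_expR.
have -> : K + K * ln y = - K + K * (2 + ln y) by ring.
rewrite lerD2l; apply: le_trans (ler_wpM2l (ltW K0) (ln_sqr_le_powR y0 g01)) _.
have -> : y `^ g = N `^ g * rho `^ g * K `^ (- g).
  rewrite /y !powRM ?mulr_ge0 ?invr_ge0 ?(ltW r0) ?(ltW K0) ?(ltW N0) //.
  by rewrite -powR_inv1 ?(ltW K0) // -powRrM mulN1r.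
have -> : K * (2 * expR 2 * (N `^ g * rho `^ g * K `^ (- g))) =
    (16 * expR 2 * K `^ (1 - g) * rho `^ g) * (N `^ g / 8).
  rewrite powRD; last by rewrite (gt_eqF K0) implybT.
  by rewrite powRr1 ?(ltW K0) //; field.
by rewrite ler_piMl // divr_ge0 ?powR_ge0.
Qed.

End BinomialDecay.

(** * Clusters of points by repeated quartering of a square *)

Section Pigeonhole.
Variable R : realType.
Implicit Types (s : seq R[i]) (x y l : R).

Definition in_square x y l (z : R[i]) : bool :=
  (x <= complex.Re z <= x + l) && (y <= complex.Im z <= y + l).

Lemma halve_square x y l s : 0 <= l -> all (in_square x y l) s ->
  exists x' y' , (size s <= 4 * count (in_square x' y' (l / 2)) s)%N.
Proof.
move=> l0 hs; pose h := l / 2; pose xh := x + h; pose yh := y + h.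
pose c a b := count (in_square a b h) s.
have : (size s <= c x y + c xh y + c x yh + c xh yh)%N.
  rewrite /c; elim: {c} s hs => [//|z s IHs] /= /andP[hz /IHs].
  suff : [|| in_square x y h z, in_square xh y h z,
             in_square x yh h z | in_square xh yh h z].
    by do 4 case: (in_square _ _ _ _) => //=; lia.
  move: hz; rewrite /in_square /xh /yh -!addrA.
  have -> : h + h = l by rewrite /h; field.
  move=> /andP[/andP[-> ->] /andP[-> ->]]; rewrite !andbT /=.
  by case: (leP (x + h) _) => [_|/ltW ->]; case: (leP (y + h) _) => [_|/ltW ->];
     rewrite ?orbT.
move=> hc.
suff [a [b hab]] : exists a b, (size s <= 4 * c a b)%N by exists a, b.
have [|h1] := leqP (size s) (4 * c x y); first by exists x, y.
have [|h2] := leqP (size s) (4 * c xh y); first by exists xh, y.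
have [|h3] := leqP (size s) (4 * c x yh); first by exists x, yh.
have [|h4] := leqP (size s) (4 * c xh yh); first by exists xh, yh.
lia.
Qed.

Definition within (w : R[i]) (rho : R) : pred R[i] :=
  fun z => modulus (w - z) <= rho.

(** Keeping the richest quarter at each stage loses at most a factor 4 in points and halves the
    side. A point of the last square lies in all of them, so one [w] serves every scale; twice the
    side bounds the diameter. *)
Lemma nested_squares J x y l s : 0 <= l -> all (in_square x y l) s -> s != [::] ->
  exists2 w, w \in s & forall j, (j <= J)%N ->
    (size s <= 4 ^ j * count (within w (2 * l * 2 ^- j)%R) s)%N.
Proof.
elim: J x y l s => [|J IHJ] x y l s l0 hs s0.
  case: s s0 hs => // w s _ hs; exists w; first exact: mem_head.
  case=> // _; rewrite expn0 mul1n expr0 invr1 mulr1.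
  rewrite (_ : count _ _ = size (w :: s)) //; apply/eqP; rewrite -all_count.
  apply/allP => z zs; rewrite /within; have := allP hs z zs; have := allP hs w (mem_head _ _).
  rewrite /in_square; case: (w) (z) => a b [a' b'] /=.
  move=> /andP[/andP[? ?] /andP[? ?]] /andP[/andP[? ?] /andP[? ?]].
  apply: le_trans (modulus_rect _ _) _.
  by rewrite (_ : 2 * l = l + l) ?lerD ?ler_norml; lra.
have [x' [y' hc]] := halve_square l0 hs.
pose P := in_square x' y' (l / 2); pose s' := [seq z <- s | P z].
have ss' : (size s <= 4 * size s')%N by rewrite size_filter.
have [||w ws' hw] := IHJ x' y' (l / 2) s' _ (filter_all _ _).
- by rewrite divr_ge0.
- by move: ss'; case: (s') => //; case: (s) s0.
exists w; first by move: ws'; rewrite mem_filter => /andP[].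
case=> [|j] jJ.
  rewrite expn0 mul1n expr0 invr1 mulr1.
  rewrite (_ : count _ _ = size s) //; apply/eqP; rewrite -all_count.
  have ws : w \in s by move: ws'; rewrite mem_filter => /andP[].
  apply/allP => z zs; rewrite /within; have := allP hs z zs; have := allP hs w ws.
  rewrite /in_square; case: (w) (z) => a b [a' b'] /=.
  move=> /andP[/andP[? ?] /andP[? ?]] /andP[/andP[? ?] /andP[? ?]].
  apply: le_trans (modulus_rect _ _) _.
  by rewrite (_ : 2 * l = l + l) ?lerD ?ler_norml; lra.
apply: leq_trans ss' _; rewrite expnS -mulnA leq_mul2l /=.
apply: leq_trans (hw j jJ) _; rewrite leq_mul2l; apply/orP; right.
have -> : 2 * l * 2 ^- j.+1 = 2 * (l / 2) * 2 ^- j :> R.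
  by rewrite exprS invfM; field; rewrite expf_neq0.
by rewrite count_filter; apply: sub_count => z /= /andP[].
Qed.

End Pigeonhole.

(** * Stretched exponential and geometric sums *)

Section StretchedSums.
Variable R : realType.
Implicit Types (g t b : R) (m L k J : nat).

Lemma powR_nat_ge_sqrt g m : 2^-1 <= g -> (m%:R : R) `^ 2^-1 <= m%:R `^ g.
Proof.
move=> g2; case: m => [|m]; first by rewrite powR0 ?powR_ge0 ?invr_eq0.
by rewrite ler_powR // ler1n.
Qed.

(** The constant must not depend on [g], so [m^g] is first replaced by [y = sqrt m]. Then
    [m + 1 <= (1 + y)^2], and [1 + y <= c^-1 exp (c y)] with [c] so small that the exponents add up
    to at most [t y]. *)
Lemma pow_le_expR_powR (t : R) k : 0 < t -> exists2 K : R, 0 < K &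
  forall g m, 2^-1 <= g -> m.+1%:R ^+ k <= K * expR (t * m%:R `^ g).
Proof.
move=> t0; pose d : R := (2 * k).+1%:R.
have d0 : 0 < d by rewrite ltr0n.
pose c := Order.min 1 (t / d).
have c0 : 0 < c by rewrite lt_min ltr01 divr_gt0.
have c1 : c <= 1 by rewrite ge_min lexx.
have cd : d * c <= t.
  by rewrite mulrC -ler_pdivlMr // ge_min lexx orbT.
exists (c ^- (2 * k)); first by rewrite invr_gt0 exprn_gt0.
move=> g m g2; set y := (m%:R : R) `^ 2^-1.
have y0 : 0 <= y by exact: powR_ge0.
have y2 : y ^+ 2 = m%:R.
  by rewrite /y powR12_sqrt // sqr_sqrtr.
have h1 : (m.+1%:R : R) <= (1 + y) ^+ 2.
  by rewrite -natr1 -y2; nra.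
apply: (@le_trans _ _ ((1 + y) ^+ (2 * k))).
  by rewrite exprM lerXn2r ?nnegrE ?exprn_ge0 ?addr_ge0.
apply: (@le_trans _ _ (c ^- (2 * k) * (1 + c * y) ^+ (2 * k))).
  rewrite -exprVn -exprMn lerXn2r ?nnegrE ?addr_ge0 //.
    by rewrite mulr_ge0 ?invr_ge0 ?(ltW c0) // addr_ge0 // mulr_ge0 // ltW.
  by rewrite mulrDr mulr1 mulKf ?gt_eqF // lerD2r invf_ge1.
rewrite ler_wpM2l ?invr_ge0 ?exprn_ge0 ?(ltW c0) //.
apply: (@le_trans _ _ (expR (c * y) ^+ (2 * k))).
  by rewrite lerXn2r ?nnegrE ?expR_ge0 ?addr_ge0 ?mulr_ge0 ?(ltW c0) // expR_ge1Dx.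
rewrite -expRM_natl ler_expR; apply: (@le_trans _ _ (t * y)); last first.
  by rewrite ler_wpM2l ?(ltW t0) // powR_nat_ge_sqrt.
rewrite mulrA ler_wpM2r //; apply: le_trans cd; rewrite ler_wpM2r ?(ltW c0) //.
by rewrite ler_nat leqnSn.
Qed.

Lemma sum_inv_sqr L : \sum_(n < L) (n.+1%:R ^+ 2)^-1 <= 2 :> R.
Proof.
(* The sharper bound [2 - 1 / (L + 1)] is the one that passes through the induction. *)
suff h : \sum_(n < L.+1) (n.+1%:R ^+ 2)^-1 <= 2 - L.+1%:R^-1 :> R.
  rewrite big_ord_recr /= in h; apply: le_trans (le_trans _ h) _.
    by rewrite lerDl invr_ge0 exprn_ge0.
  by rewrite gerBl invr_ge0.
elim: L => [|L IHL]; first by rewrite big_ord1 expr1n invr1; lra.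
rewrite big_ord_recr /=; apply: le_trans (lerD IHL (lexx _)) _.
set x : R := L.+1%:R; have x0 : 0 < x by rewrite ltr0n.
have -> : (L.+2%:R : R) = x + 1 by rewrite natr1.
rewrite -addrA lerD2l addrC lerBlDr [leRHS]addrC.
have -> : x^-1 - (x + 1)^-1 = (x * (x + 1))^-1.
  by field; rewrite !gt_eqF //; lra.
rewrite lef_pV2 ?posrE; [|by rewrite exprn_gt0 //; lra|by rewrite mulr_gt0 //; lra].
by rewrite expr2 ler_wpM2r; lra.
Qed.

(** Two extra powers of [m + 1] in [pow_le_expR_powR] leave a sum of inverse squares, uniformly in
    [g]. *)
Lemma sum_stretched_exp_bounded (t : R) k : 0 < t -> exists2 K : R, 1 <= K &
  forall g L, 2^-1 <= g ->
    \sum_(m < L) m.+1%:R ^+ k * expR (- (t * m%:R `^ g)) <= K.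
Proof.
move=> t0; have [K K0 hK] := pow_le_expR_powR k.+2 t0.
exists (1 + K * 2); first by lra.
move=> g L g2; apply: (@le_trans _ _ (\sum_(m < L) K * (m.+1%:R ^+ 2)^-1)).
  apply: ler_sum => m _; rewrite expRN ler_pdivrMr ?expR_gt0 //.
  have m0 : 0 < (m.+1%:R : R) ^+ 2 by rewrite exprn_gt0.
  rewrite mulrAC ler_pdivlMr // -exprD addn2; exact: hK.
by rewrite -mulr_sumr; have := sum_inv_sqr L; nra.
Qed.

Lemma sum_geometric_le b i : 2 <= b -> \sum_(0 <= j < i.+1) b ^+ j <= 2 * b ^+ i.
Proof.
move=> b2; elim: i => [|i IHi]; first by rewrite big_nat1 expr0; lra.
rewrite big_nat_recr //=; apply: le_trans (lerD IHi (lexx _)) _.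
have : 0 <= b ^+ i by rewrite exprn_ge0 //; lra.
rewrite exprS; nra.
Qed.

Lemma sum_geometric_tail_le (q : R) i J : 0 <= q < 1 ->
  \sum_(i <= j < J) q ^+ j <= q ^+ i / (1 - q).
Proof.
move=> /andP[q0 q1]; rewrite ler_pdivlMr; last lra.
have [iJ|Ji] := leqP i J; last by rewrite big_geq ?mul0r ?exprn_ge0 // ltnW.
suff -> : (\sum_(i <= j < J) q ^+ j) * (1 - q) = q ^+ i - q ^+ J.
  by rewrite gerBl exprn_ge0.
rewrite -(subnK iJ); elim: (J - i)%N => [|n IHn]; first by rewrite add0n big_geq // mul0r subrr.
by rewrite addSn big_nat_recr ?leq_addl //= mulrDl IHn exprS; ring.
Qed.

(** [i] is the dyadic scale of [t], cut off to the range from 0 to [J]. *)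
Lemma dyadic_scale (t : R) J : exists i, [/\ (i <= J)%N,
  i = 0%N \/ t <= 2 ^- i & i = J \/ 2 ^- i.+1 < t].
Proof.
elim: J => [|J [i [iJ h1 h2]]]; first by exists 0%N; split => //; left.
have [tJ|Jt] := leP t (2 ^- J.+1); first by exists J.+1; split => //; [right|left].
case: h2 => [e|it]; first by exists i; split=> //; [exact: leqW | right; rewrite e].
by exists i; split=> //; [exact: leqW | right].
Qed.

(** At distance [t], of dyadic scale [i], the poles with [j <= i] contribute at most [4 c b^j] each.
    Those with [j > i] are damped by [4^(i-j)], which beats [b^j] because [b < 4]. Both sums are of
    order [b^i]. *)
Lemma weight_sum_le b (c t : R) (m : nat -> R) J : 2 <= b < 4 -> 0 <= c ->
  (forall j, 0 <= m j <= c * b ^+ j) ->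
  exists i, [/\ (i <= J)%N, i = 0%N \/ t <= 2 ^- i &
    \sum_(j < J.+1) m j * (4 * (2 ^- j) ^+ 2 / ((2 ^- j) ^+ 2 + t ^+ 2)) <=
    c * (8 + 16 / (1 - b / 4)) * b ^+ i].
Proof.
move=> /andP[b2 b4] c0 hm; have [i [iJ h1 h2]] := dyadic_scale t J.
exists i; split => //.
pose f j := m j * (4 * (2 ^- j) ^+ 2 / ((2 ^- j) ^+ 2 + t ^+ 2)).
rewrite -(big_mkord xpredT f) (big_cat_nat (n := i.+1)) //=.
have r0 j : 0 < (2 ^- j : R) ^+ 2 by rewrite exprn_gt0 // invr_gt0 exprn_gt0.
have d0 j : 0 < (2 ^- j : R) ^+ 2 + t ^+ 2 by rewrite ltr_pwDl ?sqr_ge0.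
rewrite mulrDr mulrDl; apply: lerD.
  apply: (@le_trans _ _ (\sum_(0 <= j < i.+1) (4 * c) * b ^+ j)).
    apply: ler_sum => j _; rewrite /f (_ : 4 * c * b ^+ j = c * b ^+ j * 4); last by ring.
    have /andP[m0 mc] := hm j.
    apply: ler_pM => //.
      by rewrite divr_ge0 ?mulr_ge0 ?(ltW (d0 j)) ?(ltW (r0 j)).
    by rewrite ler_pdivrMr // ler_wpM2l // lerDl sqr_ge0.
  rewrite -mulr_sumr; have := sum_geometric_le i b2.
  have -> : c * 8 * b ^+ i = 4 * c * (2 * b ^+ i) by ring.
  by move=> h; rewrite ler_wpM2l // mulr_ge0.
case: h2 => [->|it].
  rewrite big_geq // !mulr_ge0 ?exprn_ge0 ?invr_ge0 //; lra.
apply: (@le_trans _ _ (\sum_(i.+1 <= j < J.+1) (16 * c * 4 ^+ i) * (b / 4) ^+ j)).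
  apply: ler_sum => j _; rewrite /f.
  have /andP[m0 mc] := hm j.
  have t2 : (4 ^+ i.+1)^-1 <= t ^+ 2.
    have -> : (4 ^+ i.+1)^-1 = (2 ^- i.+1) ^+ 2 :> R.
      by rewrite -exprVn -exprVn -exprM mulnC exprM; congr (_ ^+ _); field.
    by rewrite lerXn2r ?nnegrE ?invr_ge0 ?exprn_ge0 ?(ltW it) // (le_trans _ (ltW it)) //
      invr_ge0 exprn_ge0.
  have e4 : (2 ^- j : R) ^+ 2 = 4 ^- j.
    by rewrite -exprVn -exprVn -exprM mulnC exprM; congr (_ ^+ _); field.
  rewrite e4 in r0 d0 *.
  have -> : 16 * c * 4 ^+ i * (b / 4) ^+ j = (c * b ^+ j) * (4 * 4 ^- j * 4 ^+ i.+1).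
    by rewrite exprMn exprVn exprS; field; rewrite expf_neq0.
  apply: ler_pM => //.
    by rewrite divr_ge0 ?mulr_ge0 ?invr_ge0 ?exprn_ge0 // addr_ge0 ?sqr_ge0 // invr_ge0
      exprn_ge0.
  have q0 : 0 < (4 ^- j : R) by rewrite invr_gt0 exprn_gt0.
  rewrite ler_wpM2l ?mulr_ge0 ?(ltW q0) //.
  rewrite -[leRHS]invrK lef_pV2 ?posrE ?invr_gt0 ?exprn_gt0 //.
    by rewrite (le_trans t2) // lerDr ltW.
  by rewrite ltr_pwDl ?sqr_ge0.
rewrite -mulr_sumr; have q4 : 0 <= b / 4 < 1 by apply/andP; split; lra.
apply: le_trans (ler_wpM2l _ (sum_geometric_tail_le i.+1 J.+1 q4)) _.
  by rewrite !mulr_ge0 ?exprn_ge0.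
have -> : c * (16 / (1 - b / 4)) * b ^+ i = 16 * c * 4 ^+ i * ((b / 4) ^+ i / (1 - b / 4)).
  by rewrite exprMn exprVn; field; rewrite expf_neq0 //=; lra.
rewrite ler_wpM2l ?mulr_ge0 ?exprn_ge0 // ler_wpM2r ?invr_ge0; try lra.
by rewrite exprS ler_piMl ?exprn_ge0 //; lra.
Qed.

End StretchedSums.

(** * Smallness of a polynomial near many of its zeros *)

Section ZeroCounting.
Variable R : realType.
Implicit Types (p h : {poly R[i]}) (s : seq R[i]) (w : R[i]) (A g S : R).

(** Divide out [k] zeros near [w]. By [bin_decay] the binomial weights gain [expR (- k)] and use up
    half of the decay [n^g / 4]; the other half is summable. *)
Lemma cluster_small p h s A g (S0 : R) (k : nat) (rho : R) w :
  p = \prod_(x <- s) ('X - x%:P) * h -> all (fun x => modulus x < 1) s ->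
  (forall n, modulus p`_n <= A * expR (- (n%:R `^ g / 4))) -> 0 <= A ->
  (forall L, \sum_(n < L) expR (- (8^-1 * n%:R `^ g)) <= S0) ->
  2^-1 <= g <= 1 -> 0 < rho -> 16 * expR 2 * (k%:R `^ (1 - g)) * rho `^ g <= 1 ->
  (k <= count (within w rho) s)%N -> modulus w <= 1 ->
  modulus p.[w] <= A * S0 * expR (- k%:R).
Proof.
move=> pE s1 hp A0 hS g01 rho0 hk kc w1.
pose f := [seq x <- s | within w rho x]; pose t := take k f.
pose u := drop k f ++ [seq x <- s | ~~ within w rho x].
have st : perm_eq s (t ++ u).
  by rewrite catA cat_take_drop perm_sym; apply/permPl; exact: perm_filterC.
have szt : size t = k by rewrite size_takel // size_filter.
have pE' : p = \prod_(x <- t) ('X - x%:P) * (\prod_(x <- u) ('X - x%:P) * h).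
  by rewrite pE (perm_big _ st) big_cat /= mulrA.
have t1 : all (fun x => modulus x <= 1) t.
  apply/allP => x xt; apply/ltW/(allP s1); rewrite (perm_mem st) mem_cat xt //.
have tw : all (fun x => modulus (w - x) <= rho) t.
  by apply/allP => x /mem_take; rewrite mem_filter => /andP[].
have [L hL] := division_horner_bound pE' t1 w1 tw.
apply: (le_trans hL); rewrite szt mulr_sumr.
apply: (@le_trans _ _ (\sum_(n < L) A * expR (- k%:R) * expR (- (8^-1 * n%:R `^ g)))).
  apply: ler_sum => n _; rewrite mulrCA.
  apply: (@le_trans _ _ (A * expR (- (n%:R `^ g / 4)) * (expR (- k%:R) * expR (n%:R `^ g /
    8)))).
    apply: ler_pM; rewrite ?modulus_ge0 ?mulr_ge0 ?exprn_ge0 ?(ltW rho0) //.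
    by rewrite mulrC; exact: bin_decay.
  rewrite -!mulrA ler_wpM2l // mulrCA ler_wpM2l ?expR_ge0 // -expRD ler_expR.
  by lra.
rewrite -mulr_sumr [leRHS]mulrAC ler_wpM2l ?hS // mulr_ge0 ?expR_ge0 //.
Qed.

End ZeroCounting.

(** * Counting zeros in the disc *)

Section ZeroCluster.
Variable R : realType.
Implicit Types (p h : {poly R[i]}) (s : seq R[i]) (w : R[i]) (A g b : R).

Lemma expR_le_of_half (x M : R) : 2^-1 <= M * expR (- x) -> expR x <= 2 * M.
Proof.
rewrite expRN ler_pdivlMr ?expR_gt0 // => h.
by rewrite -(ler_pM2l (_ : 0 < 2^-1)) // mulKf.
Qed.

Lemma exprn_powR (a t : R) j : 0 <= a -> (a ^+ j) `^ t = (a `^ t) ^+ j.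
Proof.
by move=> a0; rewrite -powR_mulrn // -powRrM mulrC powRrM powR_mulrn ?powR_ge0.
Qed.

Lemma invr_powR (a t : R) : 0 <= a -> a^-1 `^ t = (a `^ t)^-1.
Proof. by move=> a0; rewrite -powR_inv1 // -powRrM mulN1r powRN. Qed.

Definition disc (r : R) : pred R[i] := fun x => modulus x <= r.

(** Jensen's inequality gains the factor [(1 - 2^-J)^(16^J) <= exp (- 8^J)]. *)
Lemma deep_zeros_bound p h s (M : R) J :
  p = \prod_(x <- s) ('X - x%:P) * h -> all (fun x => modulus x < 1) s ->
  (forall w, modulus w = 1 -> modulus p.[w] <= M) -> 0 <= M ->
  (16 ^ J <= count (disc (1 - 2 ^- J)%R) s)%N ->
  modulus p`_0 <= M * expR (- 8 ^+ J).
Proof.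
move=> pE s1 hp M0; set P := disc _; rewrite -size_filter => sJ.
pose t := [seq x <- s | P x]; pose u := [seq x <- s | ~~ P x].
have st : perm_eq s (t ++ u) by rewrite perm_sym; apply/permPl; exact: perm_filterC.
have pE' : p = \prod_(x <- t) ('X - x%:P) * (\prod_(x <- u) ('X - x%:P) * h).
  by rewrite pE (perm_big _ st) big_cat /= mulrA.
rewrite pE'; apply: le_trans (jensen_bound (M := M) _) _; first by rewrite -pE'.
rewrite ler_wpM2l //.
have q0 : 0 <= 1 - 2 ^- J :> R.
  by rewrite subr_ge0 invf_le1 ?exprn_gt0 // exprn_ege1 // ler1n.
apply: (@le_trans _ _ (\prod_(x <- t) (1 - 2 ^- J))).
  rewrite big_seq [leRHS]big_seq; apply: ler_prod => x.
  by rewrite mem_filter modulus_ge0 => /andP[].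
rewrite big_const_seq count_predT iter_mulr mulr1.
have q1 : 1 - 2 ^- J <= expR (- 2 ^- J) :> R by exact: expR_ge1Dx.
apply: (@le_trans _ _ (expR (- 2 ^- J) ^+ size t)).
  by rewrite lerXn2r ?nnegrE ?expR_ge0.
rewrite -expRM_natl ler_expR mulrN lerN2.
have -> : (8 ^+ J : R) = (16 ^ J)%N%:R * 2 ^- J.
  by rewrite natrX -exprVn -exprMn; congr (_ ^+ _); field.
by rewrite ler_wpM2r ?ler_nat // invr_ge0 exprn_ge0.
Qed.

(* [b = 2^(g/(1-g))]: about [b^j] of the zeros lie within [2^-j] of a common
   point, which makes [p] as small as [exp(- c b^j)] at that distance of it. *)
Lemma zero_cluster_bound g b : 2^-1 <= g < 1 -> 2 <= b < 4 ->
  b `^ (1 - g) = 2 `^ g ->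
  exists2 K : R, 0 < K & forall A p h s J, 1 <= A ->
    p = \prod_(x <- s) ('X - x%:P) * h -> all (fun x => modulus x < 1) s ->
    (forall n, modulus p`_n <= A * expR (- (n%:R `^ g / 4))) ->
    2^-1 <= modulus p`_0 -> (2 * 16 ^ J <= size s)%N ->
    \sum_(j < J.+1) (b / 2) ^+ j <= K * (1 + ln A).
Proof.
move=> /andP[g2 g1] /andP[b2 b4] bg.
have b0 : 0 < b by lra.
have p8 : 0 < 8^-1 :> R by rewrite invr_gt0.
have [S0 S1 hS'] := sum_stretched_exp_bounded 0 p8.
have hS L : \sum_(n < L) expR (- (8^-1 * n%:R `^ g)) <= S0.
  by apply: le_trans (hS' g L g2); apply: ler_sum => n _; rewrite expr0 mul1r.
have g0 : 0 < 1 - g by rewrite subr_gt0.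
(* With this [c], [k <= c b^j] zeros at distance [6 * 2^-j] satisfy the smallness condition of
   [cluster_small]: [96 = 16 * 6], and [b^(1-g) = 2^g] cancels the powers of [2^-j]. *)
pose c : R := (96 * expR 2) `^ (- (1 - g)^-1).
have e96 : 0 < 96 * expR 2 :> R by rewrite mulr_gt0 ?expR_gt0.
have e96' : 1 < 96 * expR 2 :> R by have := expR_ge1Dx (2 : R); lra.
have c0 : 0 < c by exact: powR_gt0.
have cg : c `^ (1 - g) = (96 * expR 2)^-1.
  by rewrite /c -powRrM mulNr mulVf ?gt_eqF // powR_inv1 // ltW.
have c1 : c < 1.
  rewrite /c powRN invf_lt1 ?powR_gt0 //.
  by rewrite /powR gt_eqF // expR_gt1 mulr_gt0 ?invr_gt0 // ln_gt0.
pose Kb : R := 8 + 16 / (1 - b / 4).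
have Kb0 : 0 < Kb.
  by rewrite /Kb ltr_pwDl // divr_ge0 //; lra.
(* [Kb] is the constant of [weight_sum_le], so pole orders up to [c' b^j] give a total weight of at
   most [exp (c b^i)]. *)
pose c' := c / Kb; have c'0 : 0 < c' by rewrite divr_gt0.
have lS : 0 <= ln (2 * S0) by rewrite ln_ge0; lra.
have lS' : 0 <= ln (2 * expR 1 * S0).
  by rewrite ln_ge0 //; have := expR_ge1Dx (1 : R); nra.
pose K2 := (10 + 8 * ln (2 * expR 1 * S0)) / c'.
have K20 : 0 <= K2 by rewrite divr_ge0 ?(ltW c'0) //; lra.
pose K1 := 2 + 2 * ln (2 * S0).
exists (K1 + K2); first by rewrite /K1; lra.
move=> A p h s J A1 pE s1 hp p0 sJ.
have A0 : 0 < A by lra.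
have lA : 0 <= ln A by exact: ln_ge0.
have KE x : x <= K1 * (1 + ln A) \/ x <= K2 * (1 + ln A) -> x <= (K1 + K2) * (1 + ln A).
  have : 0 <= K1 * (1 + ln A) by rewrite mulr_ge0 /K1; lra.
  have : 0 <= K2 * (1 + ln A) by rewrite mulr_ge0 //; lra.
  by move=> ? ? [?|?]; rewrite (mulrDl K1 K2 (1 + ln A)); lra.
have g01 : 2^-1 <= g <= 1 by rewrite g2 ltW.
(* The case [k = 0] of [cluster_small] bounds [p] on the whole circle. *)
have hcirc w : modulus w = 1 -> modulus p.[w] <= A * S0.
  move=> w1; have := @cluster_small R p h s A g S0 0 1 w pE s1 hp (ltW A0) hS g01 ltr01.
  rewrite oppr0 expR0 mulr1; apply => //; last by rewrite w1.
  by rewrite powR0 ?gt_eqF // mulr0 mul0r.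
have AS0 : 0 < A * S0 by rewrite mulr_gt0 //; lra.
have Gle : \sum_(j < J.+1) (b / 2) ^+ j <= 2 * 2 ^+ J.
  rewrite -(big_mkord xpredT (fun j => (b / 2) ^+ j)).
  apply: le_trans (sum_geometric_le J (lexx 2)); apply: ler_sum => j _.
  by rewrite lerXn2r ?nnegrE ?divr_ge0 ?(ltW b0) // ler_pdivrMr; lra.
(* Either [16^J] zeros have modulus at most [1 - 2^-J], and Jensen yields [8^J <= ln (2 A S0)], or
   at least [16^J] zeros lie beyond that radius. *)
have [deep|shallow] := leqP (16 ^ J) (count (disc (1 - 2 ^- J)%R) s).
  apply: KE; left.
  have hd := deep_zeros_bound pE s1 hcirc (ltW AS0) deep.
  have : expR (8 ^+ J) <= 2 * (A * S0).
    exact: expR_le_of_half (le_trans p0 hd).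
  move=> e8; have : ln (expR (8 ^+ J)) <= ln (2 * (A * S0)).
    by rewrite ler_ln ?posrE ?expR_gt0 // mulr_gt0.
  rewrite expRK mulrCA lnM ?posrE //; last by lra.
  move=> h8; have h28 : (2 ^+ J : R) <= 8 ^+ J by apply: lerXn2r; rewrite ?nnegrE // ler_nat.
  apply: (le_trans Gle); rewrite /K1.
  have := mulr_ge0 lS lA; set l := ln (2 * S0) in h8 *; set a := ln A in h8 *.
  have -> : (2 + 2 * l) * (1 + a) = 2 + 2 * l + 2 * a + 2 * (l * a) by ring.
  lra.
pose s' := [seq x <- s | ~~ (modulus x <= 1 - 2 ^- J)].
have s'J : (16 ^ J <= size s')%N.
  rewrite size_filter; have := count_predC (disc (1 - 2 ^- J)%R) s.
  move: shallow sJ; rewrite /predC /disc /=; set a := count _ s; set a' := count _ s.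
  by move: (size s) (16 ^ J)%N a a' => N n a a'; clear; lia.
have s'0 : s' != [::].
  by apply: contraTneq s'J => ->; rewrite -ltnNge expn_gt0.
have sq : all (in_square (-1) (-1) 2) s'.
  apply/allP => x; rewrite mem_filter => /andP[_ /(allP s1) x1].
  have := le_Re_modulus x; have := le_Im_modulus x.
  rewrite !ler_norml /in_square => /andP[h1 h2] /andP[h3 h4].
  by apply/andP; split; apply/andP; split; clear -x1 h1 h2 h3 h4; lra.
have [w0 w0s hw0] := nested_squares J (ler0n R 2) sq s'0.
have /andP[w0J w01] : ~~ (modulus w0 <= 1 - 2 ^- J) && (modulus w0 < 1).
  by move: w0s; rewrite mem_filter => /andP[-> /(allP s1) ->].
rewrite -ltNge in w0J.
have j2 j : 0 < 2 ^- j :> R by rewrite invr_gt0 exprn_gt0.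
have J1 : (2 ^- J : R) <= 1 by rewrite invf_le1 ?exprn_gt0 // exprn_ege1 // ler1n.
have w00 : 0 < modulus w0 by apply: le_lt_trans w0J; rewrite subr_ge0.
(* The radial projection to the circle moves [w0] by [1 - |w0|], which is below [2^-J]. *)
pose zeta := w0 / (modulus w0)%:C.
have z1 : modulus zeta = 1.
  by rewrite modulusM modulusV modulus_real ger0_norm ?modulus_ge0 // divff ?gt_eqF.
have zw : modulus (zeta - w0) <= 2 ^- J.
  have -> : zeta - w0 = zeta * (1 - modulus w0)%:C.
    rewrite rmorphB rmorph1 mulrBr mulr1 /zeta divfK //.
    by rewrite -modulus_eq0 modulus_real ger0_norm ?modulus_ge0 // gt_eqF.
  by rewrite modulusM z1 mul1r modulus_real ger0_norm ?subr_ge0 ?(ltW w01) // lerBlDr addrC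
    -lerBlDr ltW.
pose k j := Num.truncn (c * b ^+ j).
have kle j : (k j)%:R <= c * b ^+ j :> R.
  by rewrite truncn_le // mulr_ge0 ?(ltW c0) ?exprn_ge0 ?(ltW b0).
have kge j : c * b ^+ j - 1 <= (k j)%:R.
  by rewrite lerBlDr natr1 ltW // truncnS_gt.
(* This is the smallness of [p] at distance [2^-j] from [zeta]; the 1 in the exponent pays for the
   truncation in [k j]. *)
have small w j : modulus w = 1 -> (j <= J)%N -> j = 0%N \/ modulus (w - zeta) <= 2 ^- j ->
    modulus p.[w] <= A * S0 * expR (1 - c * b ^+ j).
  move=> w1 jJ hj; have : expR (- (k j)%:R) <= expR (1 - c * b ^+ j).
    by rewrite ler_expR lerNl opprB; exact: kge.
  move=> /(ler_wpM2l (ltW AS0)); apply: le_trans.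
  have rho0 : 0 < 6 * 2 ^- j :> R by rewrite mulr_gt0.
  apply: (cluster_small pE s1 hp (ltW A0) hS g01 rho0); last by rewrite w1.
    have h1 : (k j)%:R `^ (1 - g) <= (96 * expR 2)^-1 * (2 `^ g) ^+ j.
      apply: (@le_trans _ _ ((c * b ^+ j) `^ (1 - g))).
        rewrite ge0_ler_powR ?nnegrE ?(ltW g0) ?ler0n //.
        by rewrite mulr_ge0 ?(ltW c0) ?exprn_ge0 ?(ltW b0).
      rewrite powRM ?(ltW c0) ?exprn_ge0 ?(ltW b0) // cg -bg.
      by rewrite exprn_powR ?(ltW b0).
    have h2 : (6 * 2 ^- j) `^ g <= 6 * ((2 `^ g) ^+ j)^-1 :> R.
      rewrite powRM ?(ltW (j2 j)) //; apply: ler_pM; rewrite ?powR_ge0 //.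
        by rewrite -[leRHS]powRr1 // ler_powR ?ler1n // ltW.
      by rewrite invr_powR ?exprn_ge0 // exprn_powR.
    have q0 : 0 < (2 `^ g : R) ^+ j by rewrite exprn_gt0 ?powR_gt0.
    apply: (@le_trans _ _ (16 * expR 2 * ((96 * expR 2)^-1 * (2 `^ g) ^+ j) * (6 * ((2 `^
      g) ^+ j)^-1))).
      apply: ler_pM => //; rewrite ?powR_ge0 ?mulr_ge0 ?expR_ge0 ?powR_ge0 //.
      by rewrite ler_wpM2l ?mulr_ge0 ?expR_ge0.
    rewrite le_eqVlt; apply/orP; left; apply/eqP; field.
    by rewrite !gt_eqF ?expR_gt0.
  have cb : c * b ^+ j <= (4 ^ j)%N%:R.
    rewrite natrX; apply: (@le_trans _ _ (1 * b ^+ j)).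
      by rewrite ler_wpM2r ?exprn_ge0 ?(ltW b0) // ltW.
    by rewrite mul1r lerXn2r ?nnegrE ?(ltW b4) ?(ltW b0).
  have k4 : (k j <= 4 ^ j)%N by rewrite -(ler_nat R) (le_trans (kle j)).
  (* At scale 0 the point [w] is arbitrary on the circle; [c < 1] gives [k 0 = 0], so no zero is
     required near it. *)
  case: (posnP j) => [j0|j0].
    suff -> : k j = 0%N by [].
    apply/eqP; rewrite -leqn0 -ltnS -(ltr_nat R) (le_lt_trans (kle j)) //.
    by rewrite j0 expr0 mulr1.
  have wz : modulus (w - zeta) <= 2 ^- j by case: hj => // e; rewrite e in j0.
  (* The radius 6 is 1 from [w] to [zeta], 1 from [zeta] to [w0] and 4 from [w0] to the zero, in
     units of [2^-j]. *)
  have cnt : (count (within w0 (2 * 2 * 2 ^- j)%R) s' <= count (within w (6 * 2 ^- j)%R) s)%N.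
    rewrite count_filter; apply: sub_count => x /= /andP[hx _]; move: hx; rewrite /within => hx.
    have -> : w - x = (w - zeta) + ((zeta - w0) + (w0 - x)) by ring.
    have Jj : (2 ^- J : R) <= 2 ^- j.
      by rewrite lef_pV2 ?posrE ?exprn_gt0 // ler_weXn2l // ler1n.
    apply: le_trans (modulusD _ _) _; have := modulusD (zeta - w0) (w0 - x).
    lra.
  (* Fewer than [k j <= 4^j] zeros near [w0] would leave [s'] with fewer than [4^j * 4^j <= 16^J]
     elements. *)
  apply: leq_trans cnt; rewrite leqNgt; apply/negP => lt_k.
  have := hw0 j jJ; apply/negP; rewrite -ltnNge; apply: leq_trans s'J.
  apply: (@leq_trans (4 ^ j * 4 ^ j)).
    by rewrite ltn_pmul2l ?expn_gt0 // (leq_trans lt_k).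
  by rewrite -expnMn leq_exp2l.
pose m j := Num.truncn (c' * b ^+ j).
have mge j : c' * b ^+ j - 1 <= (m j)%:R.
  by rewrite lerBlDr natr1 ltW // truncnS_gt.
have mle j : 0 <= ((m j)%:R : R) <= c' * b ^+ j.
  by rewrite ler0n truncn_le // mulr_ge0 ?(ltW c'0) ?exprn_ge0 ?(ltW b0).
have hr j : 0 < (2 ^- j : R) <= 1.
  by rewrite j2 invf_le1 ?exprn_gt0 // exprn_ege1 // ler1n.
(* At scale [i] the weight is at most [exp (c b^i)], which cancels the smallness [exp (1 - c b^i)]
   of [p]; only the value at the origin keeps a gain. *)
have hadm : modulus p`_0 * expR (\sum_(j < J.+1) (m j)%:R * (2 ^- j / 8)) <= A * S0 * expR 1.
  apply: (@weight_admissible_poles R zeta J.+1 (fun j => 2 ^- j) m z1 hr p) => w w1.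
  have b24 : 2 <= b < 4 by rewrite b2.
  have [i [iJ hi hsum]] := weight_sum_le (modulus (w - zeta)) J b24 (ltW c'0) mle.
  apply: le_trans (ler_pM (modulus_ge0 _) (expR_ge0 _) (small w i w1 iJ hi) (_ : _ <= expR
    (c * b ^+ i))) _.
    rewrite ler_expR (le_trans hsum) // -/Kb /c' divfK ?gt_eqF //.
  by rewrite -[leLHS]mulrA -expRD subrK.
apply: KE; right.
(* Rounding each [m j] down costs at most the convergent sum of the [2^-j]. *)
have gain : (c' * \sum_(j < J.+1) (b / 2) ^+ j - 2) / 8 <= \sum_(j < J.+1) (m j)%:R * (2 ^-
  j / 8).
  have h2 : \sum_(j < J.+1) 2 ^- j <= 2 :> R.
    rewrite -(big_mkord xpredT (fun j => 2 ^- j)).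
    have q2 : 0 <= (2^-1 : R) < 1 by rewrite invr_ge0 ler0n invf_lt1 // ltr1n.
    have -> : \sum_(0 <= j < J.+1) 2 ^- j = \sum_(0 <= j < J.+1) 2^-1 ^+ j :> R.
      by apply: eq_bigr => j _; rewrite exprVn.
    apply: le_trans (sum_geometric_tail_le 0 J.+1 q2) _.
    by rewrite expr0; clear; rewrite ler_pdivrMr; lra.
  apply: (@le_trans _ _ (\sum_(j < J.+1) (c' * b ^+ j - 1) * (2 ^- j / 8))); last first.
    by apply: ler_sum => j _; rewrite ler_wpM2r ?mge // divr_ge0 // ltW.
  have -> : \sum_(j < J.+1) (c' * b ^+ j - 1) * (2 ^- j / 8) =
    (c' * (\sum_(j < J.+1) (b / 2) ^+ j) - \sum_(j < J.+1) 2 ^- j) / 8.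
    rewrite mulr_sumr -sumrB mulr_suml; apply: eq_bigr => j _.
    by rewrite exprMn exprVn; ring.
  by rewrite ler_wpM2r //; lra.
have : expR ((c' * \sum_(j < J.+1) (b / 2) ^+ j - 2) / 8) <= 2 * expR 1 * S0 * A.
  apply: (@le_trans _ _ (expR (\sum_(j < J.+1) (m j)%:R * (2 ^- j / 8))));
    first by rewrite ler_expR.
  set e := expR _ in hadm *; have e0 : 0 <= e by exact: expR_ge0.
  have : 2^-1 * e <= A * S0 * expR 1 by apply: le_trans hadm; rewrite ler_wpM2r.
  have -> : 2 * expR 1 * S0 * A = 2 * (A * S0 * expR 1) by ring.
  lra.
have q0 : 0 < 2 * expR 1 * S0 by rewrite !mulr_gt0 ?expR_gt0 //; lra.
move=> hG; have : ln (expR ((c' * \sum_(j < J.+1) (b / 2) ^+ j - 2) / 8)) <= ln (2 * expR 1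
  * S0 * A).
  by rewrite ler_ln ?posrE ?expR_gt0 // mulr_gt0.
rewrite expRK lnM ?posrE // => hfin.
rewrite /K2 mulrAC ler_pdivlMr // mulrC.
set G := \sum_(j < _) _ in hfin *; set l := ln (2 * _ * _) in hfin lS' *.
have := mulr_ge0 lS' lA; set a := ln A in hfin lA *.
have -> : (10 + 8 * l) * (1 + a) = 10 + 8 * l + 10 * a + 8 * (l * a) by ring.
clear -hfin lA lS'; lra.
Qed.

End ZeroCluster.

(** * Jost polynomials *)

Section JostPolynomials.
Variable R : realType.
Implicit Types (al be : nat -> R[i]) (g D s x : R) (m n k : nat).

(* With [z = (w + 1/w)/2], the first component is [(2w)^m det (z - J_m)] as a
   polynomial in [w], where [J_m] is the truncation of the Jacobi matrix to its
   first [m] rows and columns, [be = 2 b] and [al = 1 - 4 a c]; the second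
   component is the one of index [m - 1]. *)
Fixpoint jost_pair be al m : {poly R[i]} * {poly R[i]} :=
  if m is k.+1 then
    let: (q, q') := jost_pair be al k in
    ((1 + 'X^2 - be k *: 'X) * q - (1 - al k.-1) *: ('X^2 * q'), q)
  else (1, 0).

Definition jost_q be al m := (jost_pair be al m).1.
Definition jost_q' be al m := (jost_pair be al m).2.
Definition jost be al m := jost_q be al m - 'X^2 * jost_q' be al m.

Lemma jost_q0 be al : jost_q be al 0 = 1. Proof. by []. Qed.

Lemma jost_q'0 be al : jost_q' be al 0 = 0. Proof. by []. Qed.

Lemma jost_qS be al m : jost_q be al m.+1 =
  (1 + 'X^2 - be m *: 'X) * jost_q be al m - (1 - al m.-1) *: ('X^2 * jost_q' be al m).
Proof. by rewrite /jost_q /jost_q' /=; case: jost_pair. Qed.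

Lemma jost_q'S be al m : jost_q' be al m.+1 = jost_q be al m.
Proof. by rewrite /jost_q /jost_q' /=; case: jost_pair. Qed.

Lemma jost0 be al : jost be al 0 = 1.
Proof. by rewrite /jost /jost_q /jost_q' /= mulr0 subr0. Qed.

(** The free recursion [q_(m+1) = (1 + w^2) q_m - w^2 q_(m-1)] leaves [jost] constant, so only the
    perturbation terms survive. *)
Lemma jostS be al m : jost be al m.+1 = jost be al m -
  be m *: ('X * jost_q be al m) + al m.-1 *: ('X^2 * jost_q' be al m).
Proof.
by rewrite /jost jost_qS jost_q'S -!mul_polyC polyCB polyC1; ring.
Qed.

Lemma jost_q_split be al m : jost_q be al m.+1 = jost be al m.+1 + 'X^2 * jost_q be al m.
Proof. by rewrite /jost jost_q'S subrK. Qed.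

Lemma jostE be al m : jost be al m = jost_q be al m - 'X^2 * jost_q' be al m.
Proof. by []. Qed.

Opaque jost_q jost_q' jost.

Lemma size_jost_q be al m : (size (jost_q be al m) <= (2 * m).+1)%N /\
  (size (jost_q' be al m) <= 2 * m)%N.
Proof.
elim: m => [|m [IHq IHq']]; first by split;
  [rewrite jost_q0 size_poly1 | rewrite jost_q'0 size_poly0].
rewrite jost_q'S jost_qS; split; last by apply: leq_trans IHq _; lia.
have s2 : (size (1 + 'X^2 - be m *: 'X : {poly R[i]})%R <= 3)%N.
  rewrite (leq_trans (size_polyD _ _)) // geq_max; apply/andP; split.
    rewrite (leq_trans (size_polyD _ _)) // geq_max size_poly1 size_polyXn //.
  by rewrite size_polyN (leq_trans (size_scale_leq _ _)) // size_polyX.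
rewrite (leq_trans (size_polyD _ _)) // geq_max; apply/andP; split.
  by apply: leq_trans (size_polyMleq _ _) _; lia.
rewrite size_polyN; apply: leq_trans (size_scale_leq _ _) _.
by apply: leq_trans (size_polyMleq _ _) _;
  rewrite size_polyXn mulnS leqW // (leq_add (leqnn 2) IHq').
Qed.

Definition jost_pert be al m := modulus (be m) + modulus (al m.-1).

Definition jost_growth be al m := \prod_(k < m) (1 + k.+1%:R * jost_pert be al k).

Lemma jost_pert_ge0 be al m : 0 <= jost_pert be al m.
Proof. by rewrite addr_ge0 ?modulus_ge0. Qed.

Lemma jost_growth_ge1 be al m : 1 <= jost_growth be al m.
Proof.
rewrite /jost_growth; elim/big_ind: _ => // [x y|k _].
  exact: mulr_ege1.
by rewrite lerDl mulr_ge0 ?jost_pert_ge0.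
Qed.

Lemma jost_growth_nondecr be al m : jost_growth be al m <= jost_growth be al m.+1.
Proof.
rewrite /jost_growth big_ord_recr /= ler_peMr //.
  by rewrite (le_trans ler01) ?jost_growth_ge1.
by rewrite lerDl mulr_ge0 ?jost_pert_ge0.
Qed.

Lemma modulus_coefXM (p : {poly R[i]}) (M : R) n : 0 <= M ->
  (forall i, modulus p`_i <= M) -> modulus ('X * p)`_n <= M.
Proof. by move=> M0 hp; rewrite coefXM; case: ifP; rewrite ?modulus0. Qed.

Lemma modulus_coefXnM (p : {poly R[i]}) (M : R) k n : 0 <= M ->
  (forall i, modulus p`_i <= M) -> modulus ('X^k * p)`_n <= M.
Proof. by move=> M0 hp; rewrite coefXnM; case: ifP; rewrite ?modulus0. Qed.

(** A discrete Gronwall argument: [q_(m+1) = f_(m+1) + w^2 q_m] makes the coefficients of [q_m] sums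
    of at most [m + 1] coefficients of the [f_k], and each step changes [f] by the perturbation
    times [q]. *)
Lemma jost_coef_growth be al m n :
  [/\ modulus (jost be al m)`_n <= jost_growth be al m,
      modulus (jost_q be al m)`_n <= m.+1%:R * jost_growth be al m &
      modulus (jost_q' be al m)`_n <= m.+1%:R * jost_growth be al m].
Proof.
elim: m n => [|m IHm] n.
  have -> : jost_growth be al 0 = 1 by rewrite /jost_growth big_ord0.
  have c1 : modulus (1 : {poly R[i]})`_n <= 1.
    by rewrite coef1; case: (n == 0)%N; rewrite ?modulus1 ?modulus0.
  split; [rewrite jost0; exact: c1 | rewrite jost_q0 mulr1; exact: c1 |].
  by rewrite jost_q'0 coef0 modulus0 mulr1.
set G := jost_growth be al m; set G1 := jost_growth be al m.+1.
have G0 : 0 <= G by rewrite (le_trans ler01) ?jost_growth_ge1.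
have GG1 : G <= G1 by exact: jost_growth_nondecr.
have mG0 : 0 <= m.+1%:R * G by rewrite mulr_ge0.
have hq i : modulus (jost_q be al m)`_i <= m.+1%:R * G by have [] := IHm i.
have hq' i : modulus (jost_q' be al m)`_i <= m.+1%:R * G by have [] := IHm i.
have hf k : modulus (jost be al m.+1)`_k <= G1.
  rewrite jostS coefD coefB !coefZ /G1 /jost_growth big_ord_recr /= -/(jost_growth be al m) -/G.
  have -> : G * (1 + m.+1%:R * jost_pert be al m) = G +
      modulus (be m) * (m.+1%:R * G) + modulus (al m.-1) * (m.+1%:R * G).
    by rewrite /jost_pert; ring.
  apply: le_trans (modulusD _ _) _; apply: lerD.
    apply: le_trans (modulusD _ _) _; apply: lerD; first by have [] := IHm k.
    by rewrite modulusN modulusM ler_wpM2l ?modulus_ge0 // modulus_coefXM.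
  by rewrite modulusM ler_wpM2l ?modulus_ge0 // modulus_coefXnM.
have hS : G1 + m.+1%:R * G <= m.+2%:R * G1.
  by rewrite -[m.+2%:R]natr1 addrC mulrDl mul1r lerD2r ler_wpM2l.
split => //.
  rewrite jost_q_split coefD; apply: le_trans (modulusD _ _) _.
  by apply: le_trans hS; apply: lerD => //; exact: modulus_coefXnM.
rewrite jost_q'S; apply: le_trans (hq n) _; apply: le_trans hS.
by rewrite lerDr (le_trans G0).
Qed.

Lemma jost_coef0 be al m : (jost be al m)`_0 = 1.
Proof.
elim: m => [|m IHm]; first by rewrite jost0 coef1.
by rewrite jostS coefD coefB !coefZ coefXM coefXnM /= !mulr0 addr0 subr0.
Qed.

(** The increment [f_(k+1) - f_k] has degree at most [2 k + 1], so coefficient [n] only sees late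
    steps: decay of the perturbation in [k] becomes decay in [n]. *)
Lemma jost_coef_tail be al m n : modulus (jost be al m)`_n <= (n == 0)%:R +
  \sum_(k < m | (n <= (2 * k).+1)%N) jost_pert be al k * (k.+1%:R * jost_growth be al k).
Proof.
elim: m => [|m IHm].
  rewrite jost0 big_ord0 addr0 coef1.
  by case: (n == 0)%N; rewrite ?modulus1 ?modulus0.
have G0 : 0 <= m.+1%:R * jost_growth be al m.
  by rewrite mulr_ge0 // (le_trans ler01) ?jost_growth_ge1.
rewrite big_mkcond big_ord_recr /= -big_mkcond /= addrA jostS coefD coefB !coefZ.
rewrite -[X in modulus X]addrA; apply: le_trans (modulusD _ _) _; apply: lerD => //.
case: (leqP n (2 * m).+1) => hn.
  rewrite /jost_pert mulrDl addrC; apply: le_trans (modulusD _ _) _; rewrite addrC.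
  rewrite modulusN !modulusM; apply: lerD; rewrite ler_wpM2l ?modulus_ge0 //.
    by apply: modulus_coefXM => // i; have [] := jost_coef_growth be al m i.
  by apply: modulus_coefXnM => // i; have [] := jost_coef_growth be al m i.
have [sq sq'] := size_jost_q be al m.
rewrite coefXM coefXnM; case: n hn {IHm} => //= n; rewrite ltnS => hn.
rewrite [X in be m * X]nth_default; last exact: leq_trans hn.
case: ifP => _; rewrite ?mulr0 ?oppr0 ?add0r ?modulus0 //.
rewrite nth_default ?mulr0 ?modulus0 //; apply: leq_trans sq' _.
by clear -hn; lia.
Qed.

Lemma powR_succ g m : 0 < g <= 1 -> (m.+1%:R : R) `^ g <= m%:R `^ g + 1.
Proof.
move=> /andP[g0 g1]; case: m => [|m].
  by rewrite powR1 lerDr powR_ge0.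
set x : R := m.+1%:R; have x1 : 1 <= x by rewrite ler1n.
have x0 : 0 < x by rewrite ltr0n.
have -> : (m.+2%:R : R) = x * (1 + x^-1).
  by rewrite mulrDr mulr1 divff ?gt_eqF // natr1.
rewrite powRM ?(ltW x0) ?addr_ge0 ?invr_ge0 ?(ltW x0) //.
have h1 : (1 + x^-1) `^ g <= 1 + x^-1.
  rewrite -[leRHS]powRr1 ?addr_ge0 ?invr_ge0 ?(ltW x0) // ler_powR //.
  by rewrite lerDl invr_ge0 ltW.
apply: le_trans (ler_wpM2l (powR_ge0 _ _) h1) _.
rewrite mulrDr mulr1 lerD2l ler_pdivrMr // mul1r.
by rewrite -[leRHS]powRr1 ?(ltW x0) // ler_powR.
Qed.

Lemma le_expR_powR s x : 0 < s -> 0 < x -> x <= expR (s^-1 * x `^ s).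
Proof.
move=> s0 x0; rewrite -{1}[x]lnK ?posrE // ler_expR ler_pdivlMl // -ln_powR.
rewrite -ler_expR lnK ?posrE ?powR_gt0 //.
by apply: le_trans (expR_ge1Dx _); rewrite lerDr.
Qed.

(** The small power of [D] in the final bounds originates here: a product of factors [1 + D x_k] is
    at most the exponential of a multiple of [D^s] times the sum of the [x_k^s]. *)
Lemma add1_le_expR_powR s x : 0 < s <= 1 -> 0 <= x -> 1 + x <= expR (2 / s * x `^ s).
Proof.
move=> /andP[s0 s1] x0.
have i1 : 1 <= s^-1 by rewrite invf_ge1.
have xs0 : 0 <= x `^ s by exact: powR_ge0.
have [x1|x1] := leP x 1.
  have xx : x <= x `^ s.
    move: x0; rewrite le0r => /orP[/eqP ->|x0]; first exact: powR_ge0.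
    rewrite -[leLHS]powRr1 ?(ltW x0) // /powR gt_eqF // ler_expR mul1r.
    by have := ln_le0 x1; clear -s1; nra.
  apply: le_trans (expR_ge1Dx x) _; rewrite ler_expR; nra.
have xs1 : 1 <= x `^ s.
  by rewrite -(powRr0 x) ler_powR ?ltW.
have hx : x <= expR (s^-1 * x `^ s).
  by apply: le_expR_powR => //; apply: lt_trans x1.
have -> : 2 / s * x `^ s = s^-1 * x `^ s + s^-1 * x `^ s by ring.
rewrite expRD; apply: (@le_trans _ _ (2 * x)); first lra.
apply: ler_pM => //.
apply: le_trans (expR_ge1Dx 1) _; rewrite ler_expR; nra.
Qed.

(** The shifted index in [al m.-1] costs a factor [e], by [powR_succ]. *)
Lemma jost_pert_le be al g D m : 0 < g <= 1 -> 0 <= D ->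
  (forall n, modulus (be n) + modulus (al n) <= D * expR (- n%:R `^ g)) ->
  jost_pert be al m <= D * (1 + expR 1) * expR (- m%:R `^ g).
Proof.
move=> g01 D0 h.
have hb n : modulus (be n) <= D * expR (- n%:R `^ g).
  by apply: le_trans (h n); rewrite lerDl modulus_ge0.
have ha n : modulus (al n) <= D * expR (- n%:R `^ g).
  by apply: le_trans (h n); rewrite lerDr modulus_ge0.
rewrite mulrDr mulr1 mulrDl; apply: lerD; first exact: hb.
apply: le_trans (ha _) _; rewrite -mulrA -expRD ler_wpM2l // ler_expR.
case: m => [|m] /=; first by rewrite lerDr.
by have := powR_succ m g01; lra.
Qed.

Lemma jost_coef_decay s : 0 < s <= 1 -> exists2 K : R, 0 < K &
  forall be al g D m n, 2^-1 <= g <= 1 -> 1 <= D ->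
  (forall n, modulus (be n) + modulus (al n) <= D * expR (- n%:R `^ g)) ->
  modulus (jost be al m)`_n <= expR (K * D `^ s) * expR (- (n%:R `^ g / 4)).
Proof.
move=> s01; have /andP[s0 s1] := s01.
have [K1 K11 hK1] := sum_stretched_exp_bounded 1 s0.
have h0 : 0 < 2^-1 :> R by rewrite invr_gt0.
have [K2 K21 hK2] := sum_stretched_exp_bounded 1 h0.
pose E : R := 1 + expR 1; have E1 : 1 <= E by rewrite lerDl expR_ge0.
pose L1 := 2 / s * E * K1; have L10 : 0 <= L1.
  by rewrite !mulr_ge0 ?invr_ge0 ?(ltW s0) //; lra.
pose L2 := 1 + E * expR 1 * K2.
have EK0 : 0 <= E * expR 1 * K2 by rewrite !mulr_ge0 ?expR_ge0 //; lra.
have L21 : 1 <= L2 by rewrite lerDl.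
exists (L1 + s^-1 + ln L2).
  by rewrite ltr_pwDl ?ln_ge0 // ltr_pwDr ?invr_gt0.
move=> be al g D m n /andP[g2 g1] D1 h.
have D0 : 0 < D by lra.
have g01 : 0 < g <= 1 by apply/andP; split; lra.
have Ds1 : 1 <= D `^ s by have := ler_powR D1 (ltW s0); rewrite powRr0.
have hv k : jost_pert be al k <= D * E * expR (- k%:R `^ g).
  exact: jost_pert_le (ltW D0) h.
have hG k : jost_growth be al k <= expR (L1 * D `^ s).
  rewrite /jost_growth.
  apply: (@le_trans _ _ (\prod_(j < k) expR (2 / s * (D `^ s * E) * (j.+1%:R ^+ 1 * expR (-
    (s * j%:R `^ g)))))).
    apply: ler_prod => j _; apply/andP; split.
      by rewrite addr_ge0 // mulr_ge0 ?jost_pert_ge0.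
    apply: le_trans (add1_le_expR_powR s01 _) _.
      by rewrite mulr_ge0 ?jost_pert_ge0.
    rewrite ler_expR -[leRHS]mulrA ler_wpM2l ?divr_ge0 ?(ltW s0) //.
    apply: (@le_trans _ _ ((j.+1%:R * (D * E * expR (- j%:R `^ g))) `^ s)).
      rewrite ge0_ler_powR ?nnegrE ?(ltW s0) ?mulr_ge0 ?jost_pert_ge0 ?expR_ge0 ?(ltW D0) //;
        try lra.
      by rewrite ler_wpM2l.
    have E0 : 0 <= E by lra.
    rewrite powRM ?mulr_ge0 ?expR_ge0 ?(ltW D0) // [(D * E * _) `^ s]powRM ?mulr_ge0
      ?expR_ge0 ?(ltW D0) //.
    rewrite (@powRM _ D) ?(ltW D0) // -expRM mulNr [_ * s]mulrC expr1 mulrCA -!mulrA.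
    rewrite ler_wpM2l ?powR_ge0 //.
    apply: ler_pM; rewrite ?powR_ge0 ?mulr_ge0 ?powR_ge0 ?expR_ge0 //.
      by rewrite -[leRHS]powRr1 // ler_powR.
    rewrite ler_wpM2r ?expR_ge0 //.
    by rewrite -[leRHS]powRr1 // ler_powR // ler1n.
  rewrite -expR_sum ler_expR -mulr_sumr /L1.
  apply: le_trans (ler_wpM2l _ (hK1 g k g2)) _; last by rewrite le_eqVlt; apply/orP; left;
    apply/eqP; ring.
  by rewrite !mulr_ge0 ?invr_ge0 ?powR_ge0 ?(ltW s0) //; lra.
(* The factor [D] of a single increment is also absorbed into an exponential of [D^s]. *)
have eD : D <= expR (s^-1 * D `^ s).
  exact: le_expR_powR.
apply: le_trans (jost_coef_tail be al m n) _.
apply: (@le_trans _ _ (expR (- (n%:R `^ g / 4)) + E * expR 1 * K2 * (D * expR (L1 * D `^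
  s)) * expR (- (n%:R `^ g / 4)))).
  apply: lerD.
    case: n => [|n]; last by rewrite expR_ge0.
    by rewrite powR0 ?mul0r ?oppr0 ?expR0 // gt_eqF //; lra.
  apply: (@le_trans _ _ (\sum_(k < m) (D * E * expR (L1 * D `^ s) * expR 1 * expR (- (n%:R
    `^ g / 4))) * (k.+1%:R ^+ 1 * expR (- (2^-1 * k%:R `^ g))))).
    rewrite [leLHS]big_mkcond; apply: ler_sum => k _; case: ifP => hn; last first.
      by rewrite !mulr_ge0 ?expR_ge0 ?exprn_ge0 //; lra.
    apply: (@le_trans _ _ (D * E * expR (- k%:R `^ g) * (k.+1%:R * expR (L1 * D `^ s)))).
      have G0 : 0 <= jost_growth be al k by rewrite (le_trans ler01) ?jost_growth_ge1.
      by apply: ler_pM; rewrite ?jost_pert_ge0 ?mulr_ge0 // ler_wpM2l.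
    (* From [n <= 2 k + 1] and [2^g <= 2]. So [exp (- k^g)] splits into [exp (- n^g / 4)] and a
       factor [exp (- k^g / 2)] that is kept for the summation over [k]. *)
    have nk : n%:R `^ g <= 2 * k%:R `^ g + 1.
      apply: (@le_trans _ _ ((2 * k).+1%:R `^ g)).
        by rewrite ge0_ler_powR ?nnegrE ?ler_nat //; lra.
      apply: le_trans (powR_succ _ g01) _; rewrite lerD2r natrM powRM //.
      by rewrite ler_wpM2r ?powR_ge0 // -[leRHS]powRr1 // ler_powR // ler1n.
    have hE : expR (- k%:R `^ g) <= expR 1 * expR (- (n%:R `^ g / 4)) * expR (- (2^-1 *
      k%:R `^ g)).
      by rewrite -!expRD ler_expR; lra.
    have c0 : 0 <= D * E * k.+1%:R * expR (L1 * D `^ s).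
      by rewrite !mulr_ge0 ?expR_ge0 //; lra.
    have := ler_wpM2l c0 hE; rewrite expr1.
    set a := expR (L1 * _); set c := expR (- (_ / 4)); set d := expR 1.
    set e := expR (- (2^-1 * _)); set b := expR (- _ `^ g).
    rewrite (_ : D * E * k.+1%:R * a * b = D * E * b * (k.+1%:R * a)); last by ring.
    by rewrite (_ : D * E * k.+1%:R * a * (d * c * e) = D * E * a * d * c * (k.+1%:R * e));
      last by ring.
  rewrite -mulr_sumr; apply: le_trans (ler_wpM2l _ (hK2 g m g2)) _.
    by rewrite !mulr_ge0 ?expR_ge0 //; lra.
  by rewrite le_eqVlt; apply/orP; left; apply/eqP; ring.
rewrite -[X in X + _]mul1r -mulrDl ler_wpM2r ?expR_ge0 //.
have DX1 : 1 <= D * expR (L1 * D `^ s).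
  by rewrite mulr_ege1 // -expR0 ler_expR mulr_ge0 ?powR_ge0.
apply: (@le_trans _ _ (L2 * (D * expR (L1 * D `^ s)))).
  by rewrite /L2 [leRHS]mulrDl mul1r lerD2r.
have -> : (L1 + s^-1 + ln L2) * D `^ s =
    ln L2 * D `^ s + (s^-1 * D `^ s + L1 * D `^ s) by ring.
rewrite !expRD.
apply: ler_pM; rewrite ?mulr_ge0 ?expR_ge0 //; try lra.
  rewrite -[leLHS]lnK ?posrE; last lra.
  by rewrite ler_expR ler_peMr // ln_ge0.
by rewrite ler_wpM2r ?expR_ge0.
Qed.

End JostPolynomials.

(** * Root vectors *)

Section PolynomialAction.
Variables (F : fieldType) (V : lmodType F) (T : {linear V -> V}).
Implicit Types (p q : {poly F}) (v : V).

(** The [F[X]]-module structure on [V] in which [X] acts as [T]. *)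
Definition pact p v : V := \sum_(i < size p) p`_i *: iter i T v.

Lemma pact_wide n p v : (size p <= n)%N -> pact p v = \sum_(i < n) p`_i *: iter i T v.
Proof.
move=> pn; rewrite /pact (big_ord_widen n (fun i => p`_i *: iter i T v) pn).
rewrite big_mkcond; apply: eq_bigr => i _; case: ltnP => // hi.
by rewrite nth_default // scale0r.
Qed.

Lemma pactDl p q v : pact (p + q) v = pact p v + pact q v.
Proof.
pose n := maxn (size p) (size q).
rewrite (@pact_wide n p) ?leq_maxl // (@pact_wide n q) ?leq_maxr //.
rewrite (@pact_wide n) ?size_polyD // -big_split; apply: eq_bigr => i _.
by rewrite coefD scalerDl.
Qed.

Lemma pactZl c p v : pact (c *: p) v = c *: pact p v.
Proof.
rewrite (@pact_wide (size p)) ?size_scale_leq // /pact scaler_sumr.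
by apply: eq_bigr => i _; rewrite coefZ scalerA.
Qed.

Lemma pact0l v : pact 0 v = 0.
Proof. by rewrite /pact size_poly0 big_ord0. Qed.

Lemma pactC c v : pact c%:P v = c *: v.
Proof. by rewrite (@pact_wide 1) ?size_polyC_leq1 // big_ord1 coefC. Qed.

Lemma pactBl p q v : pact (p - q) v = pact p v - pact q v.
Proof. by rewrite pactDl -[- q]scaleN1r pactZl scaleN1r. Qed.

Lemma iter_linearD n v w : iter n T (v + w) = iter n T v + iter n T w.
Proof. by elim: n => [|n IHn] //=; rewrite IHn linearD. Qed.

Lemma iter_linearZ n c v : iter n T (c *: v) = c *: iter n T v.
Proof. by elim: n => [|n IHn] //=; rewrite IHn linearZ. Qed.

Lemma pactDr p v w : pact p (v + w) = pact p v + pact p w.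
Proof.
rewrite /pact -big_split; apply: eq_bigr => i _.
by rewrite iter_linearD scalerDr.
Qed.

Lemma pactZr p c v : pact p (c *: v) = c *: pact p v.
Proof.
rewrite /pact scaler_sumr; apply: eq_bigr => i _.
by rewrite iter_linearZ !scalerA mulrC.
Qed.

Lemma pact0r p : pact p 0 = 0.
Proof. by rewrite -[X in pact p X](scale0r (0 : V)) pactZr scale0r. Qed.

Lemma pact_sumr p (I : Type) (r : seq I) (P : pred I) (f : I -> V) :
  pact p (\sum_(i <- r | P i) f i) = \sum_(i <- r | P i) pact p (f i).
Proof. exact: (big_morph _ (pactDr p) (pact0r p)). Qed.

Lemma pactXM p v : pact ('X * p) v = T (pact p v).
Proof.
have s : (size ('X * p)%R <= (size p).+1)%N.
  by rewrite (leq_trans (size_polyMleq _ _)) // size_polyX.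
rewrite (pact_wide _ s) big_ord_recl coefXM scale0r add0r /pact linear_sum.
by apply: eq_bigr => i _; rewrite coefXM /= linearZ.
Qed.

Lemma pactM p q v : pact (p * q) v = pact p (pact q v).
Proof.
elim/poly_ind: p => [|p c IHp]; first by rewrite mul0r !pact0l.
rewrite mulrDl !pactDl mul_polyC pactZl pactC; congr (_ + _).
by rewrite [p * 'X]mulrC -mulrA !pactXM IHp.
Qed.

Lemma pactXn k v : pact 'X^k v = iter k T v.
Proof.
elim: k => [|k IHk]; first by rewrite expr0 -polyC1 pactC scale1r.
by rewrite exprS pactXM IHk.
Qed.

Lemma pactMC p q v : pact p (pact q v) = pact q (pact p v).
Proof. by rewrite -!pactM mulrC. Qed.

Lemma pact_XsubC z v : pact ('X - z%:P) v = T v - z *: v.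
Proof.
by rewrite pactBl pactC -['X]mulr1 pactXM -polyC1 pactC scale1r.
Qed.

Lemma pact_eigen p z v : pact ('X - z%:P) v = 0 -> pact p v = p.[z] *: v.
Proof.
move=> hv; elim/poly_ind: p => [|p c IHp]; first by rewrite pact0l horner0 scale0r.
rewrite pactDl pactC mulrC pactXM IHp linearZ /= hornerD hornerC hornerM hornerX.
move: hv; rewrite pact_XsubC => /eqP; rewrite subr_eq0 => /eqP ->.
by rewrite scalerA -scalerDl mulrC.
Qed.

(** Equivalently, the annihilator of [v] in [F[X]] is generated by [(X - z)^d]. *)
Definition exact_order (d : nat) (z : F) v :=
  [/\ (0 < d)%N, pact (('X - z%:P) ^+ d) v = 0 &
      pact (('X - z%:P) ^+ d.-1) v <> 0].

(** Write [p = q (X - z)^k] with [q(z) != 0]. If [k < d], then [(X - z)^(d-1-k) p] acts on [v] as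
    [q] on the eigenvector [(T - z)^(d-1) v], that is, as multiplication of this eigenvector by
    [q(z)]. *)
Lemma exact_order_dvdp d z v p : exact_order d z v -> pact p v = 0 ->
  ('X - z%:P) ^+ d %| p.
Proof.
move=> [d0 hd hd1] hp; have [->|p0] := eqVneq p 0; first exact: dvdp0.
have [k [q qz pE]] := multiplicity_XsubC p z.
move: qz pE; rewrite p0 /= => qz pE.
rewrite pE; have [dk|kd] := leqP d k; first by rewrite dvdp_mull // dvdp_exp2l.
case: hd1; set w := pact _ v.
have hw : pact ('X - z%:P) w = 0 by rewrite /w -pactM -exprS prednK.
have : pact q w = 0.
  rewrite /w -pactM; have -> : q * ('X - z%:P) ^+ d.-1 = ('X - z%:P) ^+ (d.-1 - k) * p.
    by rewrite pE mulrCA -exprD subnK // -ltnS prednK.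
  by rewrite pactM hp pact0r.
rewrite (pact_eigen _ hw) => /eqP; rewrite scaler_eq0 => /orP[|/eqP //].
by rewrite -rootE (negPf qz).
Qed.

Lemma prod_XsubC_exp_dvdp (zs : seq F) (d : F -> nat) p : uniq zs ->
  (forall z, z \in zs -> ('X - z%:P) ^+ d z %| p) ->
  \prod_(z <- zs) ('X - z%:P) ^+ d z %| p.
Proof.
elim: zs => [|z zs IHz] /=; first by rewrite big_nil dvd1p.
move=> /andP[zzs uzs] h; rewrite big_cons Gauss_dvdp ?h ?mem_head //=.
  by apply: IHz => // x xzs; rewrite h // inE xzs orbT.
rewrite big_seq; elim/big_rec: _ => [|x q xzs cq]; first exact: coprimep1.
rewrite coprimepMr cq andbT coprimep_expl // coprimep_expr // coprimep_XsubC root_XsubC.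
by apply: contraNneq zzs => <-.
Qed.

(** The product [M] of the other powers kills every summand but [u z], and is coprime to
    [(X - z)^d]. *)
Lemma sum_exact_order_dvdp (zs : seq F) (d : F -> nat) (u : F -> V) p : uniq zs ->
  (forall z, z \in zs -> exact_order (d z) z (u z)) ->
  pact p (\sum_(z <- zs) u z) = 0 ->
  \prod_(z <- zs) ('X - z%:P) ^+ d z %| p.
Proof.
move=> uzs hu hp; apply: prod_XsubC_exp_dvdp => // z zz.
pose M := \prod_(x <- zs | x != z) ('X - x%:P) ^+ d x.
have kill x : x \in zs -> x != z -> pact M (u x) = 0.
  move=> xx xz; rewrite /M (big_rem x xx) /= xz mulrC pactM.
  have [_ -> _] := hu x xx; exact: pact0r.
have : pact (M * p) (u z) = 0.
  have : pact (M * p) (\sum_(x <- zs) u x) = 0 by rewrite pactM hp pact0r.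
  rewrite pact_sumr (bigD1_seq z) //= big_seq_cond big1 ?addr0 // => x /andP[xx xz].
  by rewrite mulrC pactM kill // pact0r.
move=> /(exact_order_dvdp (hu z zz)); rewrite Gauss_dvdpr //.
rewrite /M; elim/big_rec: _ => [|x q xz cq]; first exact: coprimep1.
by rewrite coprimepMr cq andbT coprimep_expl // coprimep_expr // coprimep_XsubC root_XsubC.
Qed.

Lemma sum_exact_order_annihilated (zs : seq F) (d : F -> nat) (u : F -> V) : uniq zs ->
  (forall z, z \in zs -> exact_order (d z) z (u z)) ->
  pact (\prod_(z <- zs) ('X - z%:P) ^+ d z) (\sum_(z <- zs) u z) = 0.
Proof.
move=> uzs hu; rewrite pact_sumr big_seq big1 // => z zz.
rewrite (bigD1_seq z) //= mulrC pactM; have [_ -> _] := hu z zz; exact: pact0r.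
Qed.

End PolynomialAction.

(** * The substitution z = (w + 1/w)/2 and remainders of bounded size *)

Section Residues.
Variable R : realType.
Implicit Types (p q s : {poly R[i]}) (z w : R[i]) (m n : nat).

(* [(2w)^m p(z)] as a polynomial in [w], for [z = (w + 1/w)/2]. *)
Definition hom m p : {poly R[i]} :=
  \sum_(i < m.+1) p`_i *: ((2 *: 'X) ^+ (m - i) * (1 + 'X^2) ^+ i).

Lemma homD m p q : hom m (p + q) = hom m p + hom m q.
Proof.
by rewrite /hom -big_split; apply: eq_bigr => i _; rewrite coefD scalerDl.
Qed.

Lemma homZ m c p : hom m (c *: p) = c *: hom m p.
Proof.
by rewrite /hom scaler_sumr; apply: eq_bigr => i _; rewrite coefZ scalerA.
Qed.

Lemma homB m p q : hom m (p - q) = hom m p - hom m q.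
Proof. by rewrite homD -[- q]scaleN1r homZ scaleN1r. Qed.

Lemma hom0 m : hom m 0 = 0.
Proof. by rewrite -[X in hom m X](scale0r (0 : {poly R[i]})) homZ scale0r. Qed.

Lemma homXM m p : hom m.+1 ('X * p) = (1 + 'X^2) * hom m p.
Proof.
rewrite /hom big_ord_recl coefXM scale0r add0r mulr_sumr; apply: eq_bigr => i _.
rewrite coefXM /= /bump leq0n add1n subSS exprS -scalerAr; congr (_ *: _).
by rewrite mulrCA.
Qed.

Lemma homS m p : (size p <= m.+1)%N -> hom m.+1 p = (2 *: 'X) * hom m p.
Proof.
move=> pm; rewrite /hom big_ord_recr /= nth_default // scale0r addr0 mulr_sumr.
apply: eq_bigr => i _; rewrite subSn; last by rewrite -ltnS.
by rewrite exprS -scalerAr mulrA.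
Qed.

Lemma hom_XsubC m z p : (size p <= m.+1)%N ->
  hom m.+1 (('X - z%:P) * p) = (1 + 'X^2 - (2 * z) *: 'X) * hom m p.
Proof.
move=> pm; rewrite mulrBl mul_polyC homB homXM homZ homS //.
by rewrite [in RHS]mulrBl scalerAl scalerA [z * 2]mulrC.
Qed.

(** [hom] turns each factor [X - z] into [1 + w^2 - 2 z w], whose roots are the two preimages of
    [z]. *)
Lemma hom_prod_dvdp (l : seq R[i]) m s : (size s <= m.+1)%N ->
  \prod_(z <- l) (1 + 'X^2 - (2 * z) *: 'X) %|
    hom (size l + m) (\prod_(z <- l) ('X - z%:P) * s).
Proof.
move=> sm; elim: l => [|z l IHl]; first by rewrite big_nil dvd1p.
rewrite !big_cons -mulrA hom_XsubC ?dvdp_mul //.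
rewrite (leq_trans (size_polyMleq _ _)) // size_prod_XsubC addSn /= -addnS.
by rewrite leq_add2l.
Qed.

(** For small [B] this expresses that [p] is close to a multiple of [P]. *)
Definition bounded_residue (P : {poly R[i]}) (N : nat) (B : R) p :=
  exists r, [/\ P %| p - r, (size r <= N)%N & forall i, modulus r`_i <= B].

Lemma bounded_residueD P N B1 B2 p q : bounded_residue P N B1 p ->
  bounded_residue P N B2 q -> bounded_residue P N (B1 + B2) (p + q).
Proof.
move=> [r [d1 s1 b1]] [t [d2 s2 b2]]; exists (r + t); split.
- by rewrite opprD addrACA dvdp_add.
- by rewrite (leq_trans (size_polyD _ _)) // geq_max s1.
- by move=> i; rewrite coefD (le_trans (modulusD _ _)) // lerD.
Qed.

Lemma bounded_residueZ P N B c p : bounded_residue P N B p ->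
  bounded_residue P N (modulus c * B) (c *: p).
Proof.
move=> [r [d1 s1 b1]]; exists (c *: r); split.
- by rewrite -scalerBr -mul_polyC dvdp_mull.
- by rewrite (leq_trans (size_scale_leq _ _)).
- by move=> i; rewrite coefZ modulusM ler_wpM2l ?modulus_ge0.
Qed.

Lemma bounded_residue0 P N : bounded_residue P N 0 0.
Proof.
exists 0; rewrite subrr dvdp0 size_poly0; split => // i.
by rewrite coef0 modulus0.
Qed.

Lemma bounded_residue_sum P N (I : Type) (l : seq I) (B : I -> R) (f : I -> {poly R[i]}) :
  (forall i, bounded_residue P N (B i) (f i)) ->
  bounded_residue P N (\sum_(i <- l) B i) (\sum_(i <- l) f i).
Proof.
move=> h; elim/big_rec2: _ => [|i y x _]; first exact: bounded_residue0.
exact: bounded_residueD.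
Qed.

(** Divide by one root at a time: [X^n = w^n + (X - w) S], where the coefficients of [S] are powers
    of [w]. As [|w| < 1], their sum is at most [1 / (1 - |w|)], independently of [n]. *)
Lemma bounded_residue_Xn (l : seq R[i]) : all (fun x => modulus x < 1) l ->
  exists2 B : R, 0 <= B & forall n,
    bounded_residue (\prod_(x <- l) ('X - x%:P)) (size l) B 'X^n.
Proof.
elim: l => [|w l IHl] /=.
  move=> _; exists 0 => // n; exists 0; rewrite big_nil dvd1p size_poly0.
  by split => // i; rewrite coef0 modulus0.
move=> /andP[w1 /IHl[B B0 hB]]; pose q := modulus w.
have q0 : 0 <= q by exact: modulus_ge0.
exists (1 + 2 * (B / (1 - q))).
  by rewrite addr_ge0 // mulr_ge0 // divr_ge0 // subr_ge0 ltW.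
move=> n.
pose S : {poly R[i]} := \sum_(i < n) w ^+ (n.-1 - i) *: 'X^i.
have XnE : 'X^n = (w ^+ n)%:P + ('X - w%:P) * S.
  have -> : S = \sum_(i < n) w%:P ^+ (n.-1 - i) * 'X^i.
    by apply: eq_bigr => i _; rewrite -mul_polyC polyC_exp.
  have := subrXX_comm n (commr_polyX w%:P); rewrite -polyC_exp => h.
  by rewrite -['X - _]opprB mulNr -h opprB addrC subrK.
have [r [dr sr br]] : bounded_residue (\prod_(x <- l) ('X - x%:P)) (size l) (B / (1 - q)) S.
  have [r [dr sr br]] := bounded_residue_sum (index_enum 'I_n)
    (fun i : 'I_n => bounded_residueZ (w ^+ (n.-1 - i)) (hB i)).
  exists r; split => // i; apply: le_trans (br i) _.
  under eq_bigr do rewrite modulusX.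
  rewrite -mulr_suml mulrC ler_wpM2l // -/q.
  rewrite -[leRHS]mul1r ler_pdivlMr ?subr_gt0 //.
  case: n {S XnE dr br} => [|n]; first by rewrite big_ord0 mul0r.
  rewrite (reindex_inj rev_ord_inj) /=.
  rewrite (eq_bigr (fun j : 'I_n.+1 => q ^+ j)) => [|j _]; last first.
    by rewrite subSS subKn // -ltnS.
  by rewrite mulrC -opprB mulNr -subrX1 opprB gerBl exprn_ge0.
exists ((w ^+ n)%:P + ('X - w%:P) * r); split.
- rewrite big_cons XnE opprD addrACA subrr add0r -mulrBr dvdp_mul2l ?polyXsubC_eq0 //.
- rewrite (leq_trans (size_polyD _ _)) // geq_max (leq_trans (size_polyC_leq1 _)) //=.
  by rewrite (leq_trans (size_polyMleq _ _)) // size_XsubC.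
- move=> i; have r1 j : modulus ('X * r)`_j <= B / (1 - q).
    apply: modulus_coefXM => //.
    by rewrite divr_ge0 // subr_ge0 ltW.
  rewrite coefD (le_trans (modulusD _ _)) // lerD //.
    rewrite coefC; case: ifP => _; last by rewrite modulus0.
    by rewrite modulusX exprn_ile1 // ltW.
  rewrite mulrBl coefB (le_trans (modulusD _ _)) // mulr_natl mulr2n lerD //.
  by rewrite modulusN coefCM modulusM (le_trans _ (br i)) // ler_piMl ?modulus_ge0 // ltW.
Qed.

Lemma bounded_residue_binom (l : seq R[i]) k : all (fun x => modulus x < 1) l ->
  exists2 B : R, 0 <= B & forall n i, (i <= k)%N ->
    bounded_residue (\prod_(x <- l) ('X - x%:P)) (size l) B ('X^n * (1 + 'X^2) ^+ i).
Proof.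
move=> /bounded_residue_Xn[B B0 hB].
have h i : forall n, bounded_residue (\prod_(x <- l) ('X - x%:P)) (size l)
    (2 ^+ i * B) ('X^n * (1 + 'X^2) ^+ i).
  elim: i => [|i IHi] n; first by rewrite !expr0 mulr1 mul1r.
  have -> : 'X^n * (1 + 'X^2) ^+ i.+1 =
      'X^n * (1 + 'X^2) ^+ i + 'X^(n + 2) * (1 + 'X^2) ^+ i :> {poly R[i]}.
    by rewrite exprS mulrA mulrDr mulr1 mulrDl -exprD.
  have -> : (2 ^+ i.+1 * B : R) = 2 ^+ i * B + 2 ^+ i * B by rewrite exprS; ring.
  exact: bounded_residueD.
exists (2 ^+ k * B); first by rewrite mulr_ge0 // exprn_ge0.
move=> n i ik; have [r [d1 s1 b1]] := h i n; exists r; split => // j.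
by apply: le_trans (b1 j) _; rewrite ler_wpM2r // ler_weXn2l // ler1n.
Qed.

(** [hom m r] is a combination of at most [k] terms [X^n (1 + X^2)^i], whose coefficients carry
    powers of 2 up to [2^m]; this is why [r] is required to be of size [2^-m]. *)
Lemma bounded_residue_hom (l : seq R[i]) k : all (fun x => modulus x < 1) l ->
  exists2 B : R, 0 <= B & forall m e (r : {poly R[i]}) (eta : R), (size r <= k)%N -> (k <=
    m)%N ->
    (forall i, 2 ^+ m * modulus r`_i <= eta) ->
    bounded_residue (\prod_(x <- l) ('X - x%:P)) (size l) (B * eta) ('X^e * hom m r).
Proof.
move=> /(bounded_residue_binom k)[B B0 hB]; exists (k%:R * B); first by rewrite mulr_ge0.
move=> m e r eta rk km hr.
have -> : 'X^e * hom m r = \sum_(i < k) (r`_i * 2 ^+ (m - i)) *: ('X^(e + (m - i)) * (1 +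
  'X^2) ^+ i).
  rewrite /hom mulr_sumr.
  rewrite (big_ord_widen m.+1 (fun i => (r`_i * 2 ^+ (m - i)) *: ('X^(e + (m - i)) * (1 +
    'X^2) ^+ i))) ?leqW //.
  rewrite [RHS]big_mkcond; apply: eq_bigr => i _; case: ltnP => hi.
    by rewrite exprZn -scalerAl scalerA -scalerAr mulrA -exprD.
  by rewrite nth_default ?scale0r ?mulr0 // (leq_trans rk).
have [i|t [d1 s1 b1]] := @bounded_residue_sum (\prod_(x <- l) ('X - x%:P)) (size l)
    'I_k (index_enum _) (fun=> B * eta)
    (fun i : 'I_k => (r`_i * 2 ^+ (m - i)) *: ('X^(e + (m - i)) * (1 + 'X^2) ^+ i)).
  have [t [d1 s1 b1]] := bounded_residueZ (r`_i * 2 ^+ (m - i)) (hB (e + (m - i))%N i (ltnW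
    (ltn_ord i))).
  exists t; split => // j; apply: le_trans (b1 j) _.
  rewrite mulrC ler_wpM2l // modulusM modulusX modulus_nat mulrC.
  apply: le_trans (hr i); rewrite ler_wpM2r ?modulus_ge0 //.
  by rewrite ler_weXn2l ?leq_subr // ler1n.
exists t; split => // j; apply: le_trans (b1 j) _.
by rewrite sumr_const card_ord -mulrA mulr_natl.
Qed.

End Residues.

(** * The Jacobi operator and its characteristic polynomials *)

Section JacobiOperator.
Variable R : realType.
Implicit Types (a b c : nat -> R[i]) (z : R[i]) (p : {poly R[i]}) (m n : nat).
Implicit Types (u v : nat -> R[i]^o).

Lemma jacobi_0 a b c u : jacobi a b c u 0%N = b 0%N * u 0%N + c 0%N * u 1%N.
Proof. by rewrite /jacobi !big_ord_recr big_ord0 /= add0r. Qed.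

Lemma jacobi_S a b c u m : jacobi a b c u m.+1 =
  a m * u m + b m.+1 * u m.+1 + c m.+1 * u m.+2.
Proof.
have entry i : (i <= m)%N -> jacobi_entry a b c m.+1 i = if i == m then a m else 0.
  move=> im; rewrite /jacobi_entry gtn_eqF ?ltnS // (@ltn_eqF i) ?ltnS ?leqW //.
  by rewrite eqSS eq_sym; case: eqP => // ->.
rewrite /jacobi !big_ord_recr big1 /= => [|i _].
  rewrite add0r entry // eqxx /jacobi_entry eqxx.
  by rewrite (ltn_eqF (ltnSn _)) eqxx.
have im := ltn_ord i; rewrite (entry i (ltnW im)) (ltn_eqF im).
exact: mul0r.
Qed.

Definition jac a b c (u : nat -> R[i]^o) : nat -> R[i]^o := jacobi a b c u.

Lemma jac_is_linear a b c : linear (jac a b c).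
Proof.
move=> k u v; apply/funext => m.
have -> : (k *: jac a b c u + jac a b c v) m = k * jacobi a b c u m + jacobi a b c v m by [].
rewrite /jac /jacobi mulr_sumr -big_split; apply: eq_bigr => i _ /=.
have -> : (k *: u + v) i = k * u i + v i by [].
by rewrite mulrDr mulrCA.
Qed.

HB.instance Definition _ a b c :=
  GRing.isLinear.Build R[i] (nat -> R[i]^o) (nat -> R[i]^o) *:%R (jac a b c)
    (jac_is_linear a b c).

Definition jacL a b c : {linear (nat -> R[i]^o) -> (nat -> R[i]^o)} := jac a b c.

(** The polynomials [det (X - J_m)] and [det (X - J_(m-1))] of the truncations, by the three-term
    recursion. *)
Fixpoint char_pair a b c m : {poly R[i]} * {poly R[i]} :=
  if m is k.+1 then
    let: (p, p') := char_pair a b c k in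
    (('X - (b k)%:P) * p - (a k.-1 * c k.-1) *: p', p)
  else (1, 0).

Definition charp a b c m := (char_pair a b c m).1.
Definition charp' a b c m := (char_pair a b c m).2.

Lemma charpS a b c m : charp a b c m.+1 =
  ('X - (b m)%:P) * charp a b c m - (a m.-1 * c m.-1) *: charp' a b c m.
Proof. by rewrite /charp /charp' /=; case: char_pair. Qed.

Lemma charp'S a b c m : charp' a b c m.+1 = charp a b c m.
Proof. by rewrite /charp /charp' /=; case: char_pair. Qed.

Lemma charp0 a b c : charp a b c 0 = 1. Proof. by []. Qed.

Lemma charp'0 a b c : charp' a b c 0 = 0. Proof. by []. Qed.

Opaque charp charp'.

Lemma size_charp a b c m :
  (size (charp a b c m) <= m.+1)%N /\ (size (charp' a b c m) <= m)%N.
Proof.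
elim: m => [|m [IHp IHp']].
  by split; [rewrite charp0 size_poly1 | rewrite charp'0 size_poly0].
rewrite charp'S charpS; split => //.
rewrite (leq_trans (size_polyD _ _)) // geq_max; apply/andP; split.
  by rewrite (leq_trans (size_polyMleq _ _)) // size_XsubC.
by rewrite size_polyN (leq_trans (size_scale_leq _ _)) // 2?leqW.
Qed.

Lemma jost_q_hom a b c m :
  let be n := 2 * b n in let al n := 1 - 4 * a n * c n in
  jost_q be al m = hom m (charp a b c m) /\
  hom m.+1 (charp' a b c m) = 4 *: ('X^2 * jost_q' be al m).
Proof.
move=> be al; elim: m => [|m [IHq IHq']].
  rewrite jost_q0 jost_q'0 charp0 charp'0 hom0 mulr0 scaler0; split => //.
  by rewrite /hom big_ord1 coef1 scale1r subnn !expr0 mulr1.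
have [sp sp'] := size_charp a b c m.
rewrite jost_q'S charp'S jost_qS charpS homB homZ hom_XsubC // IHq IHq'; split.
  rewrite /be /al subKr scalerA; congr (_ - _ *: _).
  by ring.
rewrite (homS (leqW sp)) (homS sp) -!scalerAl -!scalerAr scalerA mulrA -natrM.
by rewrite expr2.
Qed.

(** Row 0 of [p_m(J)] is [c_0 ... c_(m-1)] times the [m]-th unit row. This recovers every coordinate
    of a sequence from coordinate 0 of polynomial images of it, provided no [c_k] vanishes. *)
Lemma pact_charp_0 a b c u m :
  pact (jacL a b c) (charp a b c m) u 0%N = (\prod_(k < m) c k) * u m.
Proof.
(* The sequence is generalised because the induction also uses [J u - b_m u]; the factor [c m.-1] on
   the companion identity avoids dividing by it. *)
suff h : forall m (u : nat -> R[i]^o),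
    pact (jacL a b c) (charp a b c m) u 0%N = (\prod_(k < m) c k) * u m /\
    c m.-1 * pact (jacL a b c) (charp' a b c m) u 0%N =
      if m is k.+1 then (\prod_(k < m) c k) * u k else 0.
  by have [] := h m u.
move=> {m u}; elim=> [|m IHm] u.
  rewrite charp0 charp'0 -polyC1 pactC scale1r pact0l big_ord0 mul1r.
  by split => //; rewrite mulr0.
rewrite charp'S charpS; split; last first.
  by have [-> _] := IHm u; rewrite big_ord_recr /= mulrCA mulrA.
rewrite pactBl mulrC pactM pactZl pact_XsubC.
have [e1 _] := IHm (jacL a b c u - b m *: u); have [_ e2] := IHm u.
transitivity (pact (jacL a b c) (charp a b c m) (jacL a b c u - b m *: u) 0%N -
   a m.-1 * (c m.-1 * pact (jacL a b c) (charp' a b c m) u 0%N)).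
  by rewrite mulrA.
rewrite e1 e2 big_ord_recr /=.
have -> : (jacL a b c u - b m *: u) m = jacobi a b c u m - b m * u m by [].
case: m {IHm e1 e2} => [|m]; first by rewrite big_ord0 jacobi_0; ring.
by rewrite jacobi_S /=; ring.
Qed.

Definition vanish (u : nat -> R[i]) := forall e : R, 0 < e ->
  exists M, forall m, (M <= m)%N -> modulus (u m) <= e.

Lemma vanishD u v : vanish u -> vanish v -> vanish (u + v).
Proof.
move=> hu hv e e0; have e20 : 0 < e / 2 by rewrite divr_gt0.
have [M1 h1] := hu _ e20; have [M2 h2] := hv _ e20.
exists (maxn M1 M2) => m; rewrite geq_max => /andP[m1 m2].
apply: le_trans (modulusD _ _) _; rewrite [leRHS]splitr lerD ?h1 ?h2 //.
Qed.

Lemma vanish_bounded (B : R) (u v : nat -> R[i]) :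
  (forall n, modulus (v n) <= B * modulus (u n)) -> vanish u -> vanish v.
Proof.
move=> h hu e e0; have B0 : 0 < `|B| + 1 by rewrite ltr_wpDl.
have [M hM] := hu _ (divr_gt0 e0 B0); exists M => m /hM.
rewrite ler_pdivlMr // mulrC => h2; apply: le_trans (h m) _; apply: le_trans h2.
rewrite ler_wpM2r ?modulus_ge0 // (le_trans (ler_norm _)) // lerDl //.
Qed.

Lemma vanishZ k u : vanish u -> vanish (k *: u).
Proof. by apply: (@vanish_bounded (modulus k)) => n; rewrite modulusM. Qed.

Lemma vanish0 : vanish (0 : nat -> R[i]^o).
Proof. by move=> e e0; exists 0%N => m _; rewrite modulus0 ltW. Qed.

Lemma vanish_sum (I : Type) (r : seq I) (P : pred I) (f : I -> nat -> R[i]^o) :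
  (forall i, P i -> vanish (f i)) -> vanish (\sum_(i <- r | P i) f i).
Proof. by move=> h; elim/big_rec: _ => [|i v Pi hv]; [exact: vanish0|apply: vanishD => //;
  exact: h]. Qed.

(** The second bound says that [c_0 ... c_(m-1)] is of order at most [2^-m]. *)
Definition regular a b c :=
  (exists B, forall n, [/\ modulus (a n) <= B, modulus (b n) <= B & modulus (c n) <= B]) /\
  (exists B, forall m, \prod_(k < m) (2 * modulus (c k)) <= B).

Lemma jac_vanish a b c u : regular a b c -> vanish u -> vanish (jacL a b c u).
Proof.
move=> [[B hB] _] hu.
pose v := fun n => u n.+1; pose v' := fun n => u n.+2.
have B0 : 0 <= B by have [+ _ _] := hB 0%N; apply: le_trans; exact: modulus_ge0.
have hv : vanish v by move=> e /hu[M hM]; exists M => m Mm; apply: hM; exact: leqW.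
have hv' : vanish v' by move=> e /hu[M hM]; exists M => m Mm; apply: hM; do 2!apply: leqW.
have h : vanish (fun n => jacobi a b c u n.+1).
  have : vanish ((fun n => a n * u n : R[i]^o) + (fun n => b n.+1 * v n : R[i]^o) + (fun n
    => c n.+1 * v' n : R[i]^o)).
    apply: vanishD; first apply: vanishD.
    - apply: (@vanish_bounded B u) => // n; rewrite modulusM ler_wpM2r ?modulus_ge0 //.
      by have [] := hB n.
    - apply: (@vanish_bounded B v) => // n; rewrite modulusM ler_wpM2r ?modulus_ge0 //.
      by have [] := hB n.+1.
    - apply: (@vanish_bounded B v') => // n; rewrite modulusM ler_wpM2r ?modulus_ge0 //.
      by have [] := hB n.+1.
  by move=> h e /h[M hM]; exists M => m /hM; rewrite jacobi_S.
move=> e /h[M hM]; exists M.+1 => -[//|m] Mm.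
exact: hM m Mm.
Qed.

Lemma pact_vanish a b c p u : regular a b c -> vanish u -> vanish (pact (jacL a b c) p u).
Proof.
move=> hr hu; rewrite /pact; apply: vanish_sum => i _; apply: vanishZ.
by elim: (nat_of_ord i) => [|k IHk] //=; exact: jac_vanish.
Qed.

(** The roots [z + e] and [z - e] have product 1. If neither lies in the open disc, both are on the
    circle and conjugate to each other, and [z] is their common real part. *)
Lemma joukowski_inverse z : ~ Defs.cut z ->
  exists w, modulus w < 1 /\ 'X - w%:P %| (1 + 'X^2 - (2 * z) *: 'X).
Proof.
move=> zcut; pose e := sqrtc (z ^+ 2 - 1).
have e2 : e ^+ 2 = z ^+ 2 - 1 by rewrite sqr_sqrtc.
pose w1 := z + e; pose w2 := z - e.
have w12 : w1 * w2 = 1 by rewrite mulrC /w1 /w2 -subr_sqr e2 subKr.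
have root_w w : w = w1 \/ w = w2 -> 'X - w%:P %| (1 + 'X^2 - (2 * z) *: 'X).
  move=> hw; rewrite dvdp_XsubCl /root !hornerE.
  have : w ^+ 2 = 2 * z * w - 1.
    by case: hw => ->; [rewrite /w1 sqrrD e2 | rewrite /w2 sqrrB e2]; ring.
  by move=> ->; rewrite addrCA subrr addr0 subrr.
have [h1|h1] := ltP (modulus w1) 1; first by exists w1; split => //; apply: root_w; left.
have [h2|h2] := ltP (modulus w2) 1; first by exists w2; split => //; apply: root_w; right.
exfalso; apply: zcut.
have m12 : modulus w1 * modulus w2 = 1 by rewrite -modulusM w12 modulus1.
have m1 : modulus w1 = 1.
  apply/eqP; rewrite eq_le h1 andbT -m12 ler_peMr //; lra.
have w1c : w2 = w1^*%C.
  have w10 : w1 != 0 by rewrite -modulus_gt0 m1.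
  by apply: (mulfI w10); rewrite w12 modulus_mulconj m1 expr1n.
have zE : z = (complex.Re w1)%:C.
  have : 2 * z = 2 * (complex.Re w1)%:C.
    by rewrite -addcJ -w1c /w1 /w2 addrACA subrr addr0 mulr_natl mulr2n.
  by apply: mulfI; rewrite pnatr_eq0.
exists (complex.Re w1) => //=; rewrite -ler_norml -m1; exact: le_Re_modulus.
Qed.

End JacobiOperator.

(** * Eigenvalue count when no c_n vanishes *)

Section NondegenerateCount.
Variable R : realType.
Implicit Types (a b c : nat -> R[i]) (z : R[i]) (zs : seq R[i]) (d : R[i] -> nat).
Implicit Types (u : R[i] -> nat -> R[i]^o).

Definition repeat_roots d zs := flatten [seq nseq (d z) z | z <- zs].

Lemma prod_repeat_roots d zs (f : R[i] -> {poly R[i]}) :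
  \prod_(x <- repeat_roots d zs) f x = \prod_(z <- zs) f z ^+ d z.
Proof.
rewrite big_flatten big_map; apply: eq_bigr => z _.
by rewrite big_nseq iter_mulr mulr1.
Qed.

Lemma size_repeat_roots d zs : size (repeat_roots d zs) = (\sum_(z <- zs) d z)%N.
Proof.
elim: zs => [|z zs IHz]; first by rewrite big_nil.
by rewrite /repeat_roots /= size_cat size_nseq big_cons -IHz.
Qed.

Lemma mem_repeat_roots d zs x : x \in repeat_roots d zs -> x \in zs.
Proof. by move=> /flattenP[s /mapP[z zz ->]]; rewrite mem_nseq => /andP[_ /eqP ->]. Qed.

Lemma pact_eval a b c (p : {poly R[i]}) (v : nat -> R[i]^o) n m : (size p <= n)%N ->
  pact (jacL a b c) p v m = \sum_(k < n) p`_k * iter k (jacL a b c) v m.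
Proof. by move=> pn; rewrite (pact_wide _ _ pn) fct_sumE. Qed.

Lemma dvdp_bounded_residue (P p : {poly R[i]}) N : P %| p -> bounded_residue P N 0 p.
Proof.
move=> dp; exists 0; rewrite subr0 size_poly0; split => // i.
by rewrite coef0 modulus0.
Qed.

(* The functional [p |-> (p(J) y)_0], with [y] the sum of the root vectors, has
   the annihilator of [y] as its largest ideal, so its Hankel matrix is
   invertible; and it maps [X^i p_m] to a quantity of size [o(2^-m)]. *)
Lemma charp_mod_small a b c zs d u : regular a b c -> (forall n, c n != 0) -> uniq zs ->
  (forall z, z \in zs -> exact_order (jacL a b c) (d z) z (u z)) ->
  (forall z, z \in zs -> vanish (u z)) ->
  forall e : R, 0 < e -> exists M, forall m, (M <= m)%N -> forall i,
    2 ^+ m * modulus (charp a b c m %% \prod_(z <- zs) ('X - z%:P) ^+ d z)`_i <= e.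
Proof.
move=> hreg c0 uzs hord hvan e e0.
set T := jacL a b c; pose chi := \prod_(x <- repeat_roots d zs) ('X - x%:P).
have <- : chi = \prod_(z <- zs) ('X - z%:P) ^+ d z by rewrite /chi prod_repeat_roots.
pose N := size (repeat_roots d zs); pose y := \sum_(z <- zs) u z.
have schi : size chi = N.+1 by rewrite size_prod_XsubC.
have chi0 : chi != 0 by rewrite -size_poly_eq0 schi.
have chiy : pact T chi y = 0.
  by rewrite /chi prod_repeat_roots; exact: sum_exact_order_annihilated.
have modchi (p : {poly R[i]}) (v : nat -> R[i]^o) : pact T chi v = 0 -> pact T p v = pact T
  (p %% chi) v.
  by move=> hv; rewrite {1}(divp_eq p chi) pactDl pactM hv pact0r add0r.
have smod (p : {poly R[i]}) : (size (p %% chi)%R <= N)%N by rewrite -ltnS -schi ltn_modp.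
have gam0 m : \prod_(k < m) c k != 0 by apply/prodf_neq0 => k _.
pose H : 'M[R[i]]_N := \matrix_(i, j) iter (i + j) T y 0%N.
have HE (p : {poly R[i]}) (j : 'I_N) : (size p <= N)%N ->
    \sum_(k < N) p`_k * H k j = pact T p (iter j T y) 0%N.
  move=> pN; rewrite (pact_eval _ _ _ _ _ pN); apply: eq_bigr => k _.
  by rewrite mxE iterD.
(* A kernel row gives a polynomial [X] of degree below [N] such that [v = X(J) y] has
   [(J^j v)_0 = 0] for [j < N]. Reducing [p_m] modulo [chi] then gives [v_m = 0] for all [m], so
   [chi] divides [X]. *)
have Hu : H \in unitmx.
  rewrite -row_free_unit; apply/inj_row_free => x xH.
  pose X := rVpoly x; have sX : (size X <= N)%N by exact: size_poly.
  pose v := pact T X y.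
  have hv (j : 'I_N) : iter j T v 0%N = 0.
    have := congr1 (fun A : 'rV_N => A 0 j) xH; rewrite !mxE => <-.
    rewrite -pactXn pactMC pactXn -HE //; apply: eq_bigr => k _.
    by rewrite coef_rVpoly_ord.
  have v0 : v = 0.
    apply/funext => m; apply: (mulfI (gam0 m)).
    rewrite -(pact_charp_0 a b) -/T modchi; last by rewrite pactMC chiy pact0r.
    rewrite (pact_eval _ _ _ _ _ (smod _)) big1 ?mulr0 // => k _.
    by rewrite hv mulr0.
  have chiX : chi %| X.
    by rewrite /chi prod_repeat_roots; apply: sum_exact_order_dvdp v0.
  have X0 : X = 0.
    apply/eqP/negPn/negP => X0; have := dvdp_leq X0 chiX.
    by rewrite schi leqNgt ltnS sX.
  by rewrite -[x]rVpolyK -/X X0 linear0.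
(* Solving the Hankel system writes coefficient [j] of the remainder of [p_m] as [c_0 ... c_(m-1)]
   times entry [m] of a fixed vanishing sequence. *)
pose Y (j : 'I_N) := \sum_(i < N) invmx H i j *: iter i T y.
have hY j : vanish (Y j).
  apply: vanish_sum => i _; apply: vanishZ; rewrite -pactXn.
  by apply: pact_vanish => //; rewrite /y big_seq; exact: vanish_sum.
have rE m (j : 'I_N) : (charp a b c m %% chi)`_j = (\prod_(k < m) c k) * Y j m.
  pose r := charp a b c m %% chi.
  have : poly_rV r *m H = \row_i ((\prod_(k < m) c k) * iter i T y m).
    apply/rowP => i; rewrite !mxE -(pact_charp_0 a b) -/T modchi; last first.
      by rewrite -pactXn pactMC chiy pact0r.
    by rewrite -HE //; apply: eq_bigr => k _; rewrite mxE.
  move=> /(congr1 (mulmx^~ (invmx H))); rewrite mulmxK //.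
  move=> /(congr1 (fun A : 'rV_N => A 0 j)); rewrite !mxE => ->.
  rewrite /Y fct_sumE mulr_sumr; apply: eq_bigr => i _.
  by rewrite mxE -mulrA; congr (_ * _); exact: mulrC.
have [_ [B hB]] := hreg.
have B0 : 0 <= B by apply: le_trans (hB 0%N); rewrite big_ord0.
have B1 : 0 < B + 1 by rewrite ltr_wpDl.
have hM' (j : 'I_N) : exists M, forall m, (M <= m)%N -> modulus (Y j m) <= e / (B + 1).
  exact: hY (divr_gt0 e0 B1).
have [M hM] := fin_all_exists hM'.
exists (\max_j M j) => m Mm i; have [iN|Ni] := ltnP i N; last first.
  by rewrite nth_default ?(leq_trans (smod _)) // modulus0 mulr0 ltW.
rewrite (rE m (Ordinal iN)) modulusM mulrA modulus_prod.
have -> : 2 ^+ m * \prod_(k < m) modulus (c k) = \prod_(k < m) (2 * modulus (c k)).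
  by rewrite big_split /= prodr_const card_ord.
apply: (@le_trans _ _ ((B + 1) * (e / (B + 1)))); last by rewrite mulrC divfK ?gt_eqF.
apply: ler_pM; rewrite ?modulus_ge0 //.
- by apply: prodr_ge0 => k _; rewrite mulr_ge0 ?modulus_ge0.
- by rewrite (le_trans (hB m)) // lerDl.
- by apply: hM; apply: leq_trans Mm; exact: leq_bigmax.
Qed.

(** Divide [p_m] by [chi]. The multiple of [chi] becomes under [hom] a multiple of
    [prod (1 + w^2 - 2 z w)], hence of [P]; the remainder is [o(2^-m)], so its image has a small
    residue. The polynomial [f_(m+1) = q_(m+1) - w^2 q_m] combines two such estimates. *)
Lemma jost_residue_small a b c zs d u (w : R[i] -> R[i]) :
  regular a b c -> (forall n, c n != 0) -> uniq zs ->
  (forall z, z \in zs -> exact_order (jacL a b c) (d z) z (u z)) ->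
  (forall z, z \in zs -> vanish (u z)) ->
  (forall z, z \in zs -> modulus (w z) < 1 /\ 'X - (w z)%:P %| (1 + 'X^2 - (2 * z) *: 'X)) ->
  forall e : R, 0 < e -> exists m,
    bounded_residue (\prod_(x <- map w (repeat_roots d zs)) ('X - x%:P))
      (size (repeat_roots d zs)) e
      (jost (fun n => 2 * b n) (fun n => 1 - 4 * a n * c n) m).
Proof.
move=> hreg c0 uzs hord hvan hw e e0.
set L := repeat_roots d zs; set N := size L.
have wL : all (fun x => modulus x < 1) (map w L).
  by apply/allP => _ /mapP[x /mem_repeat_roots/hw[? _] ->].
have [B B0 hB] := bounded_residue_hom N wL.
rewrite size_map -/N in hB; set P := \prod_(x <- _) _ in hB *.
pose eta := e / (2 * B + 1).
have d0 : 0 < 2 * B + 1 by rewrite ltr_wpDl // mulr_ge0.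
have eta0 : 0 < eta by rewrite divr_gt0.
have [M hM] := charp_mod_small hreg c0 uzs hord hvan eta0.
pose chi := \prod_(x <- L) ('X - x%:P).
have schi : size chi = N.+1 by rewrite size_prod_XsubC.
have chi0 : chi != 0 by rewrite -size_poly_eq0 schi.
have chiE : chi = \prod_(z <- zs) ('X - z%:P) ^+ d z by rewrite /chi prod_repeat_roots.
rewrite -chiE in hM.
have dP : P %| \prod_(x <- L) (1 + 'X^2 - (2 * x) *: 'X).
  rewrite /P big_map big_seq [X in _ %| X]big_seq.
  elim/big_rec2: _ => // x p q xL pq; apply: dvdp_mul => //.
  by have [] := hw x (mem_repeat_roots xL).
have hq m k : (maxn M N <= m)%N ->
    bounded_residue P N (B * eta) ('X^k * hom m (charp a b c m)).
  rewrite geq_max => /andP[Mm Nm].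
  have [sp _] := size_charp a b c m.
  rewrite {1}(divp_eq (charp a b c m) chi) homD mulrDr -[B * eta]add0r.
  apply: bounded_residueD; last first.
    apply: hB => //; first by rewrite -ltnS -schi ltn_modp.
    by move=> i; exact: hM.
  apply: dvdp_bounded_residue; apply: dvdp_mull; apply: dvdp_trans dP _.
  rewrite mulrC -{1}(subnKC Nm); apply: hom_prod_dvdp.
  rewrite size_divp // schi /= -subSn // leq_sub2r //.
pose m := maxn M N; exists m.+1.
rewrite jostE jost_q'S.
have [-> _] := jost_q_hom a b c m.+1; have [-> _] := jost_q_hom a b c m.
have h1 := hq m.+1 0%N (leqnSn _); rewrite expr0 mul1r in h1.
have h2 := bounded_residueZ (-1) (hq m 2%N (leqnn _)).
rewrite scaleN1r modulusN modulus1 mul1r in h2.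
have [r [d1 s1 b1]] := bounded_residueD h1 h2.
exists r; split => // i; apply: le_trans (b1 i) _.
have -> : B * eta + B * eta = e * (2 * B / (2 * B + 1)) by rewrite /eta; ring.
by rewrite ler_piMr ?(ltW e0) // ler_pdivrMr // mul1r lerDl.
Qed.

Lemma count_nondegenerate (g bb s : R) : 2^-1 <= g < 1 -> 2 <= bb < 4 ->
  bb `^ (1 - g) = 2 `^ g -> 0 < s <= 1 ->
  exists2 K : R, 0 < K & forall a b c D zs d u, 1 <= D -> regular a b c ->
    (forall n, c n != 0) -> stretched_exp_bound g D a b c -> uniq zs ->
    (forall z, z \in zs -> ~ Defs.cut z) ->
    (forall z, z \in zs -> exact_order (jacL a b c) (d z) z (u z)) ->
    (forall z, z \in zs -> vanish (u z)) ->
    forall J, (2 * 16 ^ J <= \sum_(z <- zs) d z)%N ->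
    \sum_(j < J.+1) (bb / 2) ^+ j <= K * D `^ s.
Proof.
move=> hg hbb hbg hs; have /andP[g2 g1] := hg; have /andP[s0 s1] := hs.
have [K1 K10 hK1] := zero_cluster_bound hg hbb hbg.
have [K2 K20 hK2] := jost_coef_decay hs.
exists (K1 * (1 + ln 2 + K2)).
  by rewrite mulr_gt0 // ltr_wpDl // addr_ge0 // ln_ge0 // ler1n.
move=> a b c D zs d u D1 hreg c0 hD uzs hcut hord hvan J hJ.
have D0 : 0 < D by lra.
have hw : forall z, exists w, ~ Defs.cut z ->
    modulus w < 1 /\ 'X - w%:P %| (1 + 'X^2 - (2 * z) *: 'X).
  move=> z; have [hz|hz] := pselect (Defs.cut z); first by exists 0.
  by have [w ?] := joukowski_inverse hz; exists w.
have [w {}hw] := choice hw.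
set L := repeat_roots d zs; set N := size L.
(* Subtracting the residue [r] from [f_m] makes it an exact multiple of the product. With this [e],
   the constant term stays at least 1/2 in modulus, and the decay bound survives because [r] has
   degree below [N]. *)
pose e := Order.min 2^-1 (expR (- (N%:R `^ g / 4))).
have e0 : 0 < e by rewrite lt_min expR_gt0 invr_gt0 ltr0n.
have [|m [r [dr sr br]]] := jost_residue_small hreg c0 uzs hord hvan _ e0 (w := w).
  by move=> z /hcut /hw.
pose be n := 2 * b n; pose al n := 1 - 4 * a n * c n.
rewrite -/be -/al in dr; pose p := jost be al m - r.
have hba n : modulus (be n) + modulus (al n) <= D * expR (- n%:R `^ g).
  by apply: le_trans (hD n); rewrite lerD2l /al modulusB.
have g2' : 2^-1 <= g <= 1 by rewrite g2 ltW.
have Ds1 : 1 <= D `^ s by have := ler_powR D1 (ltW s0); rewrite powRr0.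
pose A := 2 * expR (K2 * D `^ s).
have eKD : 1 <= expR (K2 * D `^ s) by rewrite -expR0 ler_expR mulr_ge0 ?powR_ge0 // ltW.
have A1 : 1 <= A by rewrite /A; lra.
have /dvdpP[h pE] := dr; rewrite mulrC in pE.
have hp n : modulus p`_n <= A * expR (- (n%:R `^ g / 4)).
  rewrite coefB; apply: le_trans (modulusD _ _) _; rewrite modulusN.
  rewrite /A -mulrA mulr_natl mulr2n; apply: lerD.
    exact: hK2.
  apply: (@le_trans _ _ (expR (- (n%:R `^ g / 4)))); last first.
    by rewrite ler_peMl ?expR_ge0.
  have [nN|Nn] := ltnP n N; last first.
    by rewrite nth_default ?(leq_trans sr) // modulus0 expR_ge0.
  apply: le_trans (br n) _; rewrite ge_min; apply/orP; right.
  rewrite ler_expR lerN2 ler_wpM2r ?invr_ge0 //.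
  have nN' : n%:R <= N%:R :> R by rewrite ler_nat ltnW.
  by apply: ge0_ler_powR; rewrite ?nnegrE ?ler0n //; clear -g2; lra.
have p0 : 2^-1 <= modulus p`_0.
  rewrite coefB jost_coef0; have := le_modulusB 1 r`_0; rewrite modulus1.
  have := br 0%N; rewrite le_min => /andP[r0 _]; clear -r0; lra.
have wL : all (fun x => modulus x < 1) (map w L).
  by apply/allP => _ /mapP[x /mem_repeat_roots/hcut/hw[? _] ->].
have := hK1 A p h (map w L) J A1 pE wL hp p0.
rewrite size_map size_repeat_roots => /(_ hJ) /le_trans; apply.
have -> : ln A = ln 2 + K2 * D `^ s by rewrite lnM ?posrE ?expR_gt0 // expRK.
rewrite -mulrA ler_wpM2l ?(ltW K10) // [leRHS]mulrDl addrA lerD2r.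
have l2 : 0 <= 1 + ln 2 :> R by rewrite addr_ge0 // ln_ge0 // ler1n.
by rewrite ler_peMr.
Qed.

End NondegenerateCount.

(** * Root spaces when no c_n vanishes *)

Section RootVectors.
Variable R : realType.
Implicit Types (a b c : nat -> R[i]) (z : R[i]) (u v : nat -> R[i]^o).

Lemma eigenvector_zero a b c z u : (forall n, c n != 0) ->
  pact (jacL a b c) ('X - z%:P) u = 0 -> u 0%N = 0 -> u = 0.
Proof.
move=> c0 hu u0; apply/funext => m.
have g0 : \prod_(k < m) c k != 0 by apply/prodf_neq0 => k _.
apply: (mulfI g0); rewrite -(pact_charp_0 a b) (pact_eigen _ hu).
by rewrite mulr0; transitivity ((charp a b c m).[z] * u 0%N); rewrite // u0 mulr0.
Qed.

(** An eigenvector is determined by its coordinate 0; descending through the powers of [J - z], a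
    root vector is determined by [k] scalars. *)
Lemma root_vector_zero a b c z u k : (forall n, c n != 0) ->
  pact (jacL a b c) (('X - z%:P) ^+ k) u = 0 ->
  (forall j, (j < k)%N -> pact (jacL a b c) (('X - z%:P) ^+ j) u 0%N = 0) -> u = 0.
Proof.
move=> c0; elim: k => [|k IHk] hk hj.
  by move: hk; rewrite expr0 -polyC1 pactC scale1r.
apply: IHk => [|j jk]; last by rewrite hj // ltnW.
apply: (@eigenvector_zero a b c z _ c0); first by rewrite -pactM -exprS.
exact: hj.
Qed.

(** If [d] independent root vectors were all killed by the power [d - 1], the [d - 1] scalars of
    [root_vector_zero] would determine them injectively, against the rank. So one has order at least
    [d], and a power of [X - z] lowers it to exactly [d]. *)
Lemma lin_indep_exact_order a b c z d (v : 'I_d -> nat -> R[i]) :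
  (forall n, c n != 0) -> (0 < d)%N ->
  (forall i, exists k, pact (jacL a b c) (('X - z%:P) ^+ k) (v i) = 0) ->
  lin_indep v -> exists i p, exact_order (jacL a b c) d z (pact (jacL a b c) p (v i)).
Proof.
case: d v => // d v c0 _ hv hind; set T := jacL a b c.
have [i hi] : exists i, pact T (('X - z%:P) ^+ d) (v i) <> 0.
  apply/not_existsP => hall.
  have {}hall i : pact T (('X - z%:P) ^+ d) (v i) = 0 by exact: contrapT (hall i).
  pose M : 'M[R[i]]_(d.+1, d) := \matrix_(i, j) pact T (('X - z%:P) ^+ j) (v i) 0%N.
  have : row_free M.
    apply/inj_row_free => x xM; pose w : nat -> R[i]^o := \sum_i x 0 i *: (v i : nat -> R[i]^o).
    have w0 : w = 0.
      apply: (@root_vector_zero a b c z _ d c0).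
        by rewrite pact_sumr big1 // => i _; rewrite pactZr hall scaler0.
      move=> j jd; rewrite pact_sumr fct_sumE.
      have := congr1 (fun A : 'rV_d => A 0 (Ordinal jd)) xM; rewrite !mxE => xMj.
      transitivity (\sum_i x 0 i * M i (Ordinal jd)); last exact: xMj.
      by apply: eq_bigr => i _; rewrite pactZr mxE.
    apply/rowP => i; rewrite mxE; apply: (hind (fun i => x 0 i)) => n.
    by have := congr1 (fun f => f n) w0; rewrite /w fct_sumE.
  by rewrite /row_free => /eqP hM; have := rank_leq_col M; rewrite hM ltnn.
have [k0 hk0] := hv i.
pose P k := `[< pact T (('X - z%:P) ^+ k) (v i) = 0 >].
have exP : exists k, P k by exists k0; apply/asboolP.
case: (ex_minnP exP) => e /asboolP he hmin.
have de : (d < e)%N.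
  rewrite ltnNge; apply/negP => ed; apply: hi.
  by rewrite -(subnK ed) exprD pactM he pact0r.
exists i, (('X - z%:P) ^+ (e - d.+1)); split; first exact: ltn0Sn.
  by rewrite -pactM -exprD subnKC.
rewrite -pactM -exprD /= => h0.
have : (e <= d + (e - d.+1))%N by apply: hmin; apply/asboolP.
by clear -de; lia.
Qed.

Lemma iter_sub_pact a b c z k u :
  iter k (fun v m => jacobi a b c v m - z * v m) u = pact (jacL a b c) (('X - z%:P) ^+ k) u.
Proof.
elim: k => [|k IHk]; first by rewrite expr0 -polyC1 pactC scale1r.
by rewrite /= IHk exprS pactM pact_XsubC.
Qed.

Lemma ell1_bounded (w : nat -> R[i]) : ell1 w -> exists2 S : R, 0 <= S &
  forall n, \sum_(k < n) modulus (w k) <= S.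
Proof.
move=> hw; pose s := series (fun n => modulus (w n)).
have nd : nondecreasing_seq s.
  by apply: nondecreasing_series => n _ _; exact: modulus_ge0.
have h n : \sum_(k < n) modulus (w k) <= limn s.
  by have := nondecreasing_cvgn_le nd hw n; rewrite /s /series /= big_mkord.
by exists (limn s) => //; have := h 0%N; rewrite big_ord0.
Qed.

Lemma ell2_vanish (w : nat -> R[i]) : ell2 w -> vanish w.
Proof.
move=> /cvg_series_cvg_0 /cvgrPdist_le h e e0.
have [N _ hN] := h (e ^+ 2) (exprn_gt0 _ e0); exists N => m Nm.
have := hN m Nm; rewrite /= sub0r normrN ger0_norm ?exprn_ge0 ?modulus_ge0 //.
by rewrite ler_pXn2r // nnegrE ?modulus_ge0 ?(ltW e0).
Qed.

Definition shift (w : nat -> R[i]) k : nat -> R[i] := fun n => w (n + k)%N.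

(** The product of the [2 |c_k|] is at most the exponential of twice the sum of the
    [|c_k - 1/2|]. *)
Lemma standing_regular a b c k : jacobi_standing a b c ->
  regular (shift a k) (shift b k) (shift c k).
Proof.
move=> [_ _ _ [/ell1_bounded[Sa Sa0 ha] /ell1_bounded[Sb Sb0 hb] /ell1_bounded[Sc Sc0 hc]]].
have term (w : nat -> R[i]) S n : (forall m, \sum_(k < m) modulus (w k) <= S) -> modulus (w
  n) <= S.
  move=> h; apply: le_trans (h n.+1); rewrite big_ord_recr /= lerDr.
  by apply: sumr_ge0 => i _; exact: modulus_ge0.
have half n (w : nat -> R[i]) : modulus (w n) <= modulus (w n - 2^-1) + 1.
  rewrite -{1}[w n](subrK 2^-1); apply: le_trans (modulusD _ _) _.
  by rewrite lerD2l modulusV modulus_nat invf_le1 // ler1n.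
split.
  exists (Sa + Sb + Sc + 1) => n; split.
  - by have := half (n + k)%N a; have := term (fun n => a n - 2^-1) _ (n + k)%N ha;
    rewrite /shift /=; lra.
  - by have := term b _ (n + k)%N hb; rewrite /shift; lra.
  - by have := half (n + k)%N c; have := term (fun n => c n - 2^-1) _ (n + k)%N hc;
    rewrite /shift /=; lra.
exists (expR (2 * Sc)) => m.
apply: (@le_trans _ _ (\prod_(j < m) expR (2 * modulus (c (j + k)%N - 2^-1)))).
  apply: ler_prod => j _; rewrite mulr_ge0 ?modulus_ge0 //=.
  apply: le_trans (expR_ge1Dx _); rewrite /shift.
  have -> : 2 * modulus (c (j + k)%N) = modulus (1 + 2 * (c (j + k)%N - 2^-1)).
    by rewrite mulrBr divff ?pnatr_eq0 // addrC subrK modulusM modulus_nat.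
  by rewrite (le_trans (modulusD _ _)) // modulus1 modulusM modulus_nat.
rewrite -expR_sum ler_expR -mulr_sumr ler_wpM2l //.
apply: le_trans (hc (k + m)%N); rewrite big_split_ord /=.
rewrite [leRHS]addrC -[leLHS]addr0; apply: lerD.
  by apply: ler_sum => j _; rewrite addnC.
by apply: sumr_ge0 => j _; exact: modulus_ge0.
Qed.

(** As [c_n] tends to 1/2, only finitely many vanish; [k] is one more than the last such index, or
    0. *)
Lemma standing_last_zero a b c : jacobi_standing a b c ->
  exists k, (forall n, shift c k n != 0) /\ (k = 0%N \/ c k.-1 = 0).
Proof.
move=> [_ /cvgrPdist_lt hc _ _].
have half0 : 0 < 2^-1 :> R by rewrite invr_gt0.
have [N _ hN] := hc _ half0.
have {hN} : forall n, (N <= n)%N -> c n != 0.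
  move=> n /hN /=; rewrite sub0r normrN ger0_norm ?modulus_ge0 // => hn.
  apply: contraTneq hn => ->; rewrite sub0r modulusN modulusV modulus_nat ltxx //.
elim: N => [|N IHN] hN.
  by exists 0%N; split; [move=> n; exact: hN | left].
have [cN|cN] := eqVneq (c N) 0.
  exists N.+1; split; last by right.
  by move=> n; apply: hN; rewrite leq_addl.
apply: IHN => n; rewrite leq_eqVlt => /orP[/eqP <- //|]; exact: hN.
Qed.

End RootVectors.

(** * Splitting off the finite block that precedes the last zero of c *)

Section Decoupling.
Variable R : realType.
Implicit Types (a b c : nat -> R[i]) (z : R[i]) (u v : nat -> R[i]^o) (k : nat).

Definition is_root_vector a b c z u :=
  vanish u /\ exists e, pact (jacL a b c) (('X - z%:P) ^+ e) u = 0.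

Lemma root_space_root_vector a b c z u : root_space (jacobi a b c) z u ->
  is_root_vector a b c z u.
Proof.
move=> [/ell2_vanish hu [e he]]; split => //; exists e.
by rewrite -iter_sub_pact; apply/funext => n; exact: he.
Qed.

Lemma is_root_vector_sum a b c z n (x : 'I_n -> R[i]) (v : 'I_n -> nat -> R[i]^o) :
  (forall i, is_root_vector a b c z (v i)) ->
  is_root_vector a b c z (\sum_i x i *: v i).
Proof.
move=> hv; split; first by apply: vanish_sum => i _; apply: vanishZ; have [] := hv i.
have h i : exists e, pact (jacL a b c) (('X - z%:P) ^+ e) (v i) = 0 by have [] := hv i.
have [e he] := fin_all_exists h.
exists (\max_i e i); rewrite pact_sumr big1 // => i _.
have ei : (e i <= \max_j e j)%N by exact: leq_bigmax.
by rewrite -(subnK ei) exprD pactZr pactM he pact0r scaler0.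
Qed.

Definition trunc k u : 'rV[R[i]]_k := \row_i u i.

(* When [c (k - 1) = 0] the first [k] rows of the matrix only involve the first
   [k] coordinates. *)
Definition head_mx a b c k : 'M[R[i]]_k := \matrix_(i, j) jacobi_entry a b c j i.

Lemma jacobi_wide a b c u m n : (m.+2 <= n)%N ->
  jacobi a b c u m = \sum_(i < n) jacobi_entry a b c m i * u i.
Proof.
move=> mn; rewrite /jacobi.
rewrite (big_ord_widen n (fun i => jacobi_entry a b c m i * u i) mn) big_mkcond.
apply: eq_bigr => i _; case: ltnP => // mi.
have mi' := ltnW mi.
rewrite /jacobi_entry (ltn_eqF mi') (gtn_eqF mi) (@ltn_eqF m i.+1) ?mul0r //.
by rewrite ltnS ltnW.
Qed.

Lemma trunc_jacobi a b c k u : k = 0%N \/ c k.-1 = 0 ->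
  trunc k (jacL a b c u) = trunc k u *m head_mx a b c k.
Proof.
move=> hk; apply/rowP => j; rewrite !mxE; have jk := ltn_ord j.
transitivity (jacobi a b c u j); first by [].
rewrite (@jacobi_wide _ _ _ _ _ k.+1) ?ltnS // big_ord_recr /=.
(* In the first [k] rows, column [k] can only contain [c k.-1]. *)
have -> : jacobi_entry a b c j k = 0.
  rewrite /jacobi_entry (ltn_eqF jk) (@ltn_eqF j k.+1) ?leqW //.
  case: eqP => // e; case: hk => [k0|ck].
    by have := leq_ltn_trans (leq0n j) jk; rewrite [X in (_ < X)%N]k0.
  by have /= e' := congr1 predn e; rewrite -e'.
by rewrite mul0r addr0; apply: eq_bigr => i _; rewrite !mxE mulrC.
Qed.

(** By induction on the exponent the head of [(J - z) u] vanishes, so a nonzero head of [u] would be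
    an eigenvector of the block. *)
Lemma trunc_root_vector a b c k z u : k = 0%N \/ c k.-1 = 0 ->
  ~~ root (char_poly (head_mx a b c k)) z -> is_root_vector a b c z u ->
  trunc k u = 0.
Proof.
move=> hk hz [_ [e he]]; elim: e u he => [|e IHe] u he.
  have -> : u = 0 by move: he; rewrite expr0 -polyC1 pactC scale1r.
  by apply/rowP => i; rewrite !mxE.
apply/eqP/negPn/negP => u0; move: hz; rewrite -eigenvalue_root_char => /negP; apply.
apply/eigenvalueP; exists (trunc k u) => //; apply/eqP.
rewrite -subr_eq0 -trunc_jacobi // -(IHe (pact (jacL a b c) ('X - z%:P) u)).
  by apply/eqP/rowP => i; rewrite pact_XsubC !mxE.
by rewrite -pactM -exprSr.
Qed.

Lemma shift_pact a b c k z u e : k = 0%N \/ c k.-1 = 0 ->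
  (forall i, (i < k)%N -> u i = 0) ->
  (forall i, (i < k)%N -> pact (jacL a b c) (('X - z%:P) ^+ e) u i = 0) /\
  shift (pact (jacL a b c) (('X - z%:P) ^+ e) u) k =
  pact (jacL (shift a k) (shift b k) (shift c k)) (('X - z%:P) ^+ e) (shift u k).
Proof.
move=> hk; elim: e u => [|e IHe] u hu.
  by rewrite expr0 -polyC1 !pactC !scale1r.
rewrite exprSr !pactM; set u1 := pact (jacL a b c) ('X - z%:P) u.
have E n : u1 n = jacobi a b c u n - z * u n by rewrite /u1 pact_XsubC.
have hu1 i : (i < k)%N -> u1 i = 0.
  move=> ik; have := congr1 (fun A : 'rV_k => A 0 (Ordinal ik)) (trunc_jacobi a b u hk).
  have -> : trunc k u = 0 by apply/rowP => j; rewrite !mxE hu.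
  by rewrite mul0mx !mxE E hu // mulr0 subr0.
have [h1 h2] := IHe u1 hu1; split; first exact: h1.
apply: (etrans h2); set T := jacL (shift a k) (shift b k) (shift c k).
apply: (f_equal (pact T (('X - z%:P) ^+ e))).
apply/funext => n; rewrite pact_XsubC /shift E.
transitivity (jacobi (shift a k) (shift b k) (shift c k) (shift u k) n - z * shift u k n);
  last by [].
congr (_ - _); case: n => [|n].
  rewrite jacobi_0 /shift !add0n add1n; case: k {hk u1 E hu1 h1 h2 IHe T} hu => [|k] hu.
    by rewrite jacobi_0.
  by rewrite jacobi_S hu // mulr0 add0r.
by rewrite jacobi_S /shift !addSn jacobi_S.
Qed.

(** Take the combinations whose first [k] coordinates vanish. This costs the rank of the matrix of
    heads, which is at most [k], and is 0 unless [z] is an eigenvalue of the block. Shifting such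
    combinations loses nothing. *)
Lemma tail_family a b c k z d (v : 'I_d -> nat -> R[i]) : k = 0%N \/ c k.-1 = 0 ->
  (forall i, is_root_vector a b c z (v i)) -> lin_indep v ->
  exists d' (v' : 'I_d' -> nat -> R[i]),
    [/\ (d <= d' + root (char_poly (head_mx a b c k)) z * k)%N,
        forall i, is_root_vector (shift a k) (shift b k) (shift c k) z (v' i) &
        lin_indep v'].
Proof.
move=> hk hv hind; pose M : 'M[R[i]]_(d, k) := \matrix_(i, j) v i j.
pose K := kermx M; exists (\rank K); pose B := row_base K.
pose w (l : 'I_(\rank K)) : nat -> R[i]^o := \sum_i B l i *: (v i : nat -> R[i]^o).
have wE l n : w l n = \sum_i B l i * v i n by rewrite /w fct_sumE.
have w0 l j : (j < k)%N -> w l j = 0.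
  move=> jk; have : B *m M = 0 by apply/sub_kermxP; rewrite eq_row_base.
  move=> /(congr1 (fun A : 'M[R[i]]_(\rank K, k) => A l (Ordinal jk))); rewrite !mxE wE => BM.
  transitivity (\sum_i B l i * M i (Ordinal jk)); last exact: BM.
  by apply: eq_bigr => i _; rewrite [M _ _]mxE.
exists (fun l => shift (w l) k); split.
- rewrite mxrank_ker; case: (boolP (root _ z)) => hz.
    rewrite mul1n; have := rank_leq_col M; have := rank_leq_row M; clear; lia.
  suff -> : M = 0 by rewrite mxrank0 subn0 leq_addr.
  apply/matrixP => i j; rewrite !mxE.
  have := trunc_root_vector hk hz (hv i).
  by move=> /(congr1 (fun A : 'rV_k => A 0 j)); rewrite !mxE.
- move=> l; have [vw [e he]] := is_root_vector_sum (B l) hv.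
  split.
    by move=> eps /vw[N hN]; exists N => m Nm; apply: hN; rewrite (leq_trans Nm) ?leq_addr.
  exists e; have [_ <-] := @shift_pact a b c k z (w l) e hk (w0 l).
  by rewrite he.
- move=> y hy l.
  have hyw n : \sum_l y l * w l n = 0.
    have [nk|kn] := ltnP n k; first by rewrite big1 // => i _; rewrite w0 ?mulr0.
    by rewrite -(subnK kn); exact: hy.
  have : (\row_l y l) *m B = 0.
    apply/rowP => i; rewrite !mxE.
    apply: (hind (fun i => \sum_j (\row_l y l) 0 j * B j i)) => n.
    rewrite -[RHS](hyw n); under eq_bigr do rewrite mulr_suml.
    rewrite exchange_big; apply: eq_bigr => j _; rewrite wE mulr_sumr.
    by apply: eq_bigr => i' _; rewrite mxE mulrA.
  have Bf : row_free B by exact: row_base_free.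
  rewrite -(mul0mx 1 B) => /(row_free_inj Bf).
  by move=> /(congr1 (fun A : 'rV_(\rank K) => A 0 l)); rewrite !mxE.
Qed.

(** At an index [n] with [c n = 0], the term [|4 a c - 1|] equals 1, so [1 <= D exp (- n^g)] and
    [sqrt n <= n^g <= ln D]. *)
Lemma last_zero_bound (g D : R) a b c k : 2^-1 <= g -> 1 <= D ->
  stretched_exp_bound g D a b c -> k = 0%N \/ c k.-1 = 0 ->
  k%:R <= 1 + ln D ^+ 2.
Proof.
move=> g2 D1 hD hk; have l0 : 0 <= ln D by exact: ln_ge0.
have D0 : 0 < D by exact: lt_le_trans D1.
case: k hk => [|k] hk; first by rewrite addr_ge0 ?exprn_ge0.
have {hk} ck : c k = 0 by case: hk.
have := hD k; rewrite ck mulr0 sub0r modulusN modulus1 => h.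
have {h} : 1 <= D * expR (- k%:R `^ g).
  by apply: le_trans h; rewrite lerDr modulus_ge0.
rewrite expRN ler_pdivlMr ?expR_gt0 // mul1r => h.
have {}h : k%:R `^ g <= ln D by rewrite -ler_expR lnK ?posrE.
have {}h : (k%:R : R) `^ 2^-1 <= ln D by apply: le_trans h; exact: powR_nat_ge_sqrt.
rewrite -natr1 addrC lerD2l.
have -> : (k%:R : R) = (k%:R `^ 2^-1) ^+ 2 by rewrite powR12_sqrt // sqr_sqrtr.
by rewrite lerXn2r ?nnegrE ?powR_ge0.
Qed.

(** [N] counts what remains after the shift. The block has at most [k] eigenvalues, and each costs
    at most [k] dimensions, whence [k * k]. *)
Lemma finite_count (g bb s : R) : 2^-1 <= g < 1 -> 2 <= bb < 4 ->
  bb `^ (1 - g) = 2 `^ g -> 0 < s <= 1 ->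
  exists2 K : R, 0 < K & forall a b c D (zs : seq R[i]) (d : R[i] -> nat), 1 <= D ->
    jacobi_standing a b c -> stretched_exp_bound g D a b c -> uniq zs ->
    (forall z, z \in zs -> ~ Defs.cut z) ->
    (forall z, z \in zs -> exists v : 'I_(d z) -> nat -> R[i],
       (forall i, root_space (jacobi a b c) z (v i)) /\ lin_indep v) ->
    exists N k, [/\ (\sum_(z <- zs) d z <= N + k * k)%N, k%:R <= 1 + ln D ^+ 2 &
      forall J, (2 * 16 ^ J <= N)%N -> \sum_(j < J.+1) (bb / 2) ^+ j <= K * D `^ s].
Proof.
move=> hg hbb hbg hs; have /andP[g2 g1] := hg.
have [K K0 hK] := count_nondegenerate hg hbb hbg hs.
exists K => // a b c D zs d D1 hst hD uzs hcut hfam.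
have [k [c0 hk]] := standing_last_zero hst.
pose ch := char_poly (head_mx a b c k).
pose T := jacL (shift a k) (shift b k) (shift c k).
have hreg := standing_regular k hst.
have : forall z, exists du : nat * (nat -> R[i]^o), z \in zs ->
    (d z <= du.1 + root ch z * k)%N /\
    ((0 < du.1)%N -> exact_order T du.1 z du.2 /\ vanish du.2).
  move=> z; have [zz|] := boolP (z \in zs); last by exists (0%N, 0).
  have [v [hv hind]] := hfam z zz.
  have hv' i : is_root_vector a b c z (v i) by exact: root_space_root_vector.
  have [d' [v' [dd' hr hi]]] := tail_family hk hv' hind.
  have [d0|d0] := posnP d'; first by exists (0%N, 0) => _; split => //; rewrite -d0.
  have hr' i : exists e, pact T (('X - z%:P) ^+ e) (v' i) = 0 by have [] := hr i.
  have [i [p hp]] := lin_indep_exact_order c0 d0 hr' hi.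
  exists (d', pact T p (v' i)) => _; split => // _; split => //.
  by apply: pact_vanish => //; have [] := hr i.
move=> /choice[du hdu]; pose d' z := (du z).1.
pose zs' := [seq z <- zs | (0 < d' z)%N].
exists (\sum_(z <- zs') d' z)%N, k; split.
- have -> : (\sum_(z <- zs') d' z = \sum_(z <- zs) d' z)%N.
    rewrite big_filter big_mkcond; apply: eq_bigr => z _.
    by case: posnP.
  apply: (@leq_trans (\sum_(z <- zs) (d' z + root ch z * k))%N).
    by rewrite !big_seq; apply: leq_sum => z /hdu[].
  rewrite big_split leq_add2l /= -big_distrl leq_mul2r; apply/orP; right.
  rewrite -big_mkcond /= sum1_count.
  have ch0 : ch != 0 by rewrite monic_neq0 // char_poly_monic.
  have := max_poly_roots ch0 (filter_all (root ch) zs) (filter_uniq _ uzs).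
  by rewrite size_char_poly ltnS size_filter.
- exact: (@last_zero_bound g D a b c k g2 D1 hD hk).
- move=> J hJ.
  have mz z : z \in zs' -> (0 < d' z)%N /\ z \in zs by rewrite mem_filter => /andP[].
  apply: (hK (shift a k) (shift b k) (shift c k) D zs' d' (fun z => (du z).2) D1 hreg c0 _
    _ _ _ _ J hJ).
  + move=> n; apply: le_trans (hD (n + k)%N) _.
    rewrite ler_wpM2l ?(le_trans ler01) // ler_expR lerN2.
    by rewrite ge0_ler_powR ?nnegrE // ?ler_nat ?leq_addr //; clear -g2; lra.
  + exact: filter_uniq.
  + by move=> z /mz[_ /hcut].
  + by move=> z /mz[dz /hdu[_ /(_ dz)[]]].
  + by move=> z /mz[dz /hdu[_ /(_ dz)[]]].
Qed.

End Decoupling.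

(** * Counting eigenvalues *)

Section EigenvalueCount.
Variable R : realType.
Implicit Types (a b c : nat -> R[i]) (z : R[i]) (g D s : R).

Lemma alg_mult_attained (T : (nat -> R[i]) -> nat -> R[i]) z (B : R) :
  (forall d (v : 'I_d -> nat -> R[i]), (forall i, root_space T z (v i)) ->
     lin_indep v -> d%:R <= B) ->
  exists d, alg_mult T z = (d%:R)%:E /\
    exists v : 'I_d -> nat -> R[i], (forall i, root_space T z (v i)) /\ lin_indep v.
Proof.
move=> hB; pose P d := `[< exists v : 'I_d -> nat -> R[i],
  (forall i, root_space T z (v i)) /\ lin_indep v >].
have exP : exists d, P d.
  exists 0%N; apply/asboolP; exists (fun i : 'I_0 => fun=> 0).
  by split; [case | move=> y _ []].
have ubP d : P d -> (d <= Num.bound B)%N.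
  move=> /asboolP[v [hv hi]]; have dB := hB d v hv hi.
  have B0 : 0 <= B by apply: le_trans dB.
  by rewrite -(ler_nat R) (le_trans dB) // ltW // archi_boundP.
case: (ex_maxnP exP ubP) => d /asboolP hd dmax; exists d; split => //.
apply/eqP; rewrite eq_le; apply/andP; split.
  apply: ge_ereal_sup => _ [e he <-]; rewrite lee_fin ler_nat.
  by apply: dmax; apply/asboolP.
by apply: ereal_sup_ubound; exists d.
Qed.

(** A singleton list already shows each multiplicity to be finite and attained, so the extended sum
    is a supremum over finite families of independent root vectors. *)
Lemma N_jacobi_le a b c (B : R) :
  (forall (zs : seq R[i]) (d : R[i] -> nat), uniq zs ->
     (forall z, z \in zs -> ~ Defs.cut z) ->
     (forall z, z \in zs -> exists v : 'I_(d z) -> nat -> R[i],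
        (forall i, root_space (jacobi a b c) z (v i)) /\ lin_indep v) ->
     (\sum_(z <- zs) d z)%N%:R <= B) ->
  (N_jacobi a b c <= B%:E)%E.
Proof.
move=> hB.
have hz z : exists d, ~ Defs.cut z -> alg_mult (jacobi a b c) z = (d%:R)%:E /\
    exists v : 'I_d -> nat -> R[i],
      (forall i, root_space (jacobi a b c) z (v i)) /\ lin_indep v.
  have [zc|zc] := pselect (Defs.cut z); first by exists 0%N.
  have [|d hd] := @alg_mult_attained (jacobi a b c) z B; last by exists d.
  move=> d v hv hi.
  have := hB [:: z] (fun=> d) isT; rewrite big_seq1; apply.
    by move=> x; rewrite inE => /eqP ->.
  by move=> x; rewrite inE => /eqP ->; exists v.
have [d hd] := choice hz.
rewrite /N_jacobi /esum; apply: ge_ereal_sup => _ [A [Afin AI] <-].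
have [s As] := (finite_seqP _).1 Afin.
have {}As : A = [set` undup s] by rewrite As; apply/seteqP; split => x /=; rewrite mem_undup.
have memA z : z \in undup s -> ~ Defs.cut z.
  by move=> zs; have : A z by [rewrite As]; move=> /AI[].
rewrite As -fsbig_seq ?undup_uniq // big_seq.
rewrite (eq_bigr (fun z => ((d z)%:R)%:E)) => [|z /memA zc]; last by have [->] := hd z zc.
rewrite -big_seq sumEFin lee_fin -natr_sum; apply: hB => [|z /memA //|z /memA zc].
  exact: undup_uniq.
by have [_] := hd z zc.
Qed.

(** From [ln D <= t^-1 D^t] with [t = s / 4], since the logarithm occurs to the fourth power. *)
Lemma ln_growth s : 0 < s <= 1 -> exists2 K : R, 0 < K &
  forall D, 1 <= D -> (1 + ln D ^+ 2) ^+ 2 <= K * D `^ s.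
Proof.
move=> /andP[s0 s1]; pose t := s / 4; have t0 : 0 < t by rewrite divr_gt0.
exists ((1 + t^-1 ^+ 2) ^+ 2).
  by rewrite exprn_gt0 // ltr_pwDl // exprn_ge0 // invr_ge0 ltW.
move=> D D1; have D0 : 0 < D by exact: lt_le_trans D1.
have l0 : 0 <= ln D by exact: ln_ge0.
pose x := D `^ t; have x1 : 1 <= x by have := ler_powR D1 (ltW t0); rewrite powRr0.
have x0 : 0 <= x by exact: le_trans x1.
have -> : D `^ s = (x ^+ 2) ^+ 2.
  rewrite -exprM -powR_mulrn // /x -powRrM /t; congr (_ `^ _); by field.
have lx : ln D <= t^-1 * x by rewrite -ler_expR lnK ?posrE //; exact: le_expR_powR.
rewrite -exprMn lerXn2r ?nnegrE ?addr_ge0 ?mulr_ge0 ?exprn_ge0 ?addr_ge0 ?exprn_ge0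
  ?invr_ge0 ?(ltW t0) //.
rewrite mulrDl mul1r; apply: lerD; first by rewrite exprn_ege1.
by rewrite -exprMn lerXn2r ?nnegrE ?mulr_ge0 ?invr_ge0 ?(ltW t0).
Qed.

Lemma dyadic_size N : (N < 2)%N \/ exists J, (2 * 16 ^ J <= N < 2 * 16 ^ J.+1)%N.
Proof.
have [N2|N2] := ltnP N 2; [by left|right].
have h0 : (0 < N %/ 2)%N by rewrite divn_gt0.
have /andP[h1 h2] := trunc_log_bounds (isT : (1 < 16)%N) h0.
exists (trunc_log 16 (N %/ 2)); move: h1 h2.
move: (16 ^ _)%N (16 ^ _)%N => p q h1 h2; have := divn_eq N 2.
have := ltn_pmod N (isT : (0 < 2)%N); lia.
Qed.

(** Here [b = 2], so the geometric sum is [J + 1], at most [K sqrt D], while [N < 2 * 16^(J+1)]. *)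
Lemma eigenvalue_count_half : exists2 C : R, 0 < C & forall D a b c, 1 <= D ->
  jacobi_standing a b c -> stretched_exp_bound 2^-1 D a b c ->
  (N_jacobi a b c <= (expR (C * Num.sqrt D))%:E)%E.
Proof.
have s01 : 0 < (2^-1 : R) <= 1 by rewrite invr_gt0 ltr0n invf_le1 // ler1n.
have g01 : 2^-1 <= (2^-1 : R) < 1 by rewrite lexx invf_lt1 // ltr1n.
have bb01 : 2 <= (2 : R) < 4 by rewrite lexx ltr_nat.
have bbE : (2 : R) `^ (1 - 2^-1) = 2 `^ 2^-1 by congr (_ `^ _); field.
have [K K0 hK] := finite_count g01 bb01 bbE s01.
have [K2 K20 hK2] := ln_growth s01.
have l16 : 0 < ln 16 :> R by rewrite ln_gt0 // ltr1n.
pose al := K * ln 16; have al0 : 0 < al by rewrite mulr_gt0.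
have l2 : 0 <= ln (2 + K2) by rewrite ln_ge0 //; lra.
exists (ln (2 + K2) + (al + 1)); first by lra.
move=> D a b c D1 hst hD; apply: N_jacobi_le => zs d uzs hcut hfam.
have [N [k [hN hk hJ]]] := hK a b c D zs d D1 hst hD uzs hcut hfam.
set r := Num.sqrt D.
have rE : D `^ 2^-1 = r by rewrite powR12_sqrt // (le_trans ler01).
have r1 : 1 <= r by have := @ler_wsqrtr R 1 D D1; rewrite sqrtr1.
have hNr : N%:R <= 2 * expR (al * r).
  have e1 : 1 <= expR (al * r) by rewrite -expR0 ler_expR mulr_ge0 // ?(ltW al0) //
    (le_trans ler01).
  have [N2|[J /andP[J1 J2]]] := dyadic_size N.
    by apply: (@le_trans _ _ 2); [rewrite ler_nat ltnW | rewrite ler_peMr].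
  have := hJ J J1; rewrite divff ?pnatr_eq0 // rE.
  under eq_bigr do rewrite expr1n.
  rewrite sumr_const card_ord => hJr.
  apply: (@le_trans _ _ (2 * 16 ^ J.+1)%N%:R); first by rewrite ler_nat ltnW.
  rewrite natrM natrX ler_wpM2l //.
  have -> : (16 : R) = expR (ln 16) by rewrite lnK ?posrE ?ltr0n.
  by rewrite -expRM_natl ler_expR /al [leRHS]mulrAC ler_wpM2r ?(ltW l16) //.
have hk2 : (k * k)%N%:R <= K2 * r.
  rewrite -rE; apply: le_trans (hK2 D D1); rewrite natrM -expr2.
  by rewrite lerXn2r ?nnegrE ?ler0n ?addr_ge0 ?exprn_ge0 ?ln_ge0.
have er : r <= expR ((al + 1) * r).
  apply: (@le_trans _ _ (1 + r)); first by rewrite lerDr.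
  apply: le_trans (expR_ge1Dx r) _; rewrite ler_expR ler_peMl //; lra.
have er2 : expR (al * r) <= expR ((al + 1) * r) by rewrite ler_expR mulrDl lerDl; lra.
apply: (@le_trans _ _ (2 * expR (al * r) + K2 * r)).
  by apply: le_trans (lerD hNr hk2); rewrite -natrD ler_nat.
apply: (@le_trans _ _ ((2 + K2) * expR ((al + 1) * r))).
  by rewrite [leRHS]mulrDl lerD // ler_wpM2l // ltW.
rewrite [leRHS](_ : _ = expR (ln (2 + K2) * r) * expR ((al + 1) * r));
  last by rewrite -expRD -mulrDl.
rewrite ler_wpM2r ?expR_ge0 // -[leLHS]lnK ?posrE; last by lra.
by rewrite ler_expR ler_peMr.
Qed.

Lemma two_powR_lt (x y : R) : x < y -> (2 : R) `^ x < 2 `^ y.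
Proof. by move=> xy; rewrite /powR gt_eqF // ltr_expR ltr_pM2r // ln_gt0 // ltr1n. Qed.

(** The restriction [g <= 3/5] keeps [b = 2^(g/(1-g))] below 4. With [16 <= (b/2)^P] and [s = 1/P],
    the last term [(b/2)^J <= K D^s] yields [16^J <= K^P D]. *)
Lemma eigenvalue_count_gt_half g : 2^-1 < g <= 3 / 5 -> exists2 C : R, 0 < C &
  forall D a b c, 1 <= D -> jacobi_standing a b c -> stretched_exp_bound g D a b c ->
  (N_jacobi a b c <= (C * D)%:E)%E.
Proof.
move=> /andP[g2 g35].
have g1 : 0 < 1 - g by lra.
pose tau := g / (1 - g).
have tau1 : 1 < tau by rewrite /tau ltr_pdivlMr //; lra.
have tau2 : tau < 2 by rewrite /tau ltr_pdivrMr //; lra.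
pose bb : R := 2 `^ tau.
have bbE : bb `^ (1 - g) = 2 `^ g by rewrite /bb -powRrM /tau divfK // gt_eqF.
have bb2 : 2 < bb by have := two_powR_lt tau1; rewrite powRr1.
have bb4 : bb < 4.
  by have := two_powR_lt tau2; rewrite powR_mulrn // (_ : 2 ^+ 2 = 4) //; ring.
have g01 : 2^-1 <= g < 1 by apply/andP; split; lra.
have bb01 : 2 <= bb < 4 by rewrite (ltW bb2).
pose th := bb / 2; have th1 : 1 < th by rewrite /th ltr_pdivlMr // mul1r.
have th0 : 0 < th by exact: lt_trans th1.
have lth : 0 < ln th by exact: ln_gt0.
have [P [Pgt0 hP]] : exists P, (0 < P)%N /\ 16 <= th ^+ P.
  have h : 16 / ln th < (Num.bound (16 / ln th))%:R.
    by rewrite archi_boundP // divr_ge0 // ltW.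
  move: (Num.bound _) h => B h; rewrite ltr_pdivrMr // in h.
  exists B.+1; split => //; rewrite -[th]lnK ?posrE // -expRM_natl.
  apply: le_trans (expR_ge1Dx _); apply: le_trans (ltW h) _.
  apply: (@le_trans _ _ (B.+1%:R * ln th)); last by rewrite lerDr.
  by rewrite ler_wpM2r ?(ltW lth) // ler_nat.
have P0 : 0 < P%:R :> R by rewrite ltr0n.
have s01 : 0 < (P%:R^-1 : R) <= 1 by rewrite invr_gt0 P0 invf_le1 // ler1n.
have [K K0 hK] := finite_count g01 bb01 bbE s01.
have one1 : 0 < (1 : R) <= 1 by rewrite ltr01 lexx.
have [K2 K20 hK2] := ln_growth one1.
have KP : 0 < K ^+ P by rewrite exprn_gt0.
exists (2 + 32 * K ^+ P + K2); first by lra.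
move=> D a b c D1 hst hD; apply: N_jacobi_le => zs d uzs hcut hfam.
have [N [k [hN hk hJ]]] := hK a b c D zs d D1 hst hD uzs hcut hfam.
have D0 : 0 <= D by exact: le_trans D1.
have hNr : N%:R <= (2 + 32 * K ^+ P) * D.
  have [N2|[J /andP[J1 J2]]] := dyadic_size N.
    apply: (@le_trans _ _ (2 * 1)); first by rewrite mulr1 ler_nat ltnW.
    by apply: ler_pM => //; lra.
  apply: (@le_trans _ _ (2 * 16 ^ J.+1)%N%:R); first by rewrite ler_nat ltnW.
  rewrite natrM natrX exprS.
  have thJ : th ^+ J <= K * D `^ P%:R^-1.
    apply: le_trans (hJ J J1); rewrite big_ord_recr /= -/th lerDr.
    by apply: sumr_ge0 => j _; rewrite exprn_ge0 // ltW.
  have : 16 ^+ J <= K ^+ P * D :> R.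
    apply: (@le_trans _ _ ((th ^+ J) ^+ P)).
      rewrite -exprM mulnC exprM lerXn2r ?nnegrE ?exprn_ge0 ?(ltW th0) //.
    have -> : K ^+ P * D = (K * D `^ P%:R^-1) ^+ P.
      by rewrite exprMn -[(_ `^ _) ^+ P]powR_mulrn ?powR_ge0 // -powRrM mulVf ?gt_eqF // powRr1.
    by rewrite lerXn2r ?nnegrE ?exprn_ge0 ?mulr_ge0 ?powR_ge0 ?(ltW th0) ?(ltW K0).
  have -> : (2 + 32 * K ^+ P) * D = 2 * D + 32 * (K ^+ P * D) by ring.
  by move: (K ^+ P * D) (16 ^+ J) D0 => x y; clear; lra.
have hk2 : (k * k)%N%:R <= K2 * D.
  rewrite -[X in _ * X]powRr1 //; apply: le_trans (hK2 D D1); rewrite natrM -expr2.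
  by rewrite lerXn2r ?nnegrE ?ler0n ?addr_ge0 ?exprn_ge0 ?ln_ge0.
rewrite [leRHS]mulrDl; apply: le_trans (lerD hNr hk2).
by rewrite -natrD ler_nat.
Qed.

Lemma stretched_exp_bound_le (g g' D : R) a b c : 0 < g' -> g' <= g -> 0 <= D ->
  stretched_exp_bound g D a b c -> stretched_exp_bound g' D a b c.
Proof.
move=> g0 gg D0 h n; apply: le_trans (h n) _; rewrite ler_wpM2l // ler_expR lerN2.
case: n => [|n]; first by rewrite powR0 ?powR_ge0 // gt_eqF.
by rewrite ler_powR // ler1n.
Qed.

End EigenvalueCount.

Theorem corollary1p5 (R : realType) :
  (exists C : R, 0 < C /\
    forall (gamma D : R) (a b c : nat -> R[i]),
      2^-1 <= gamma < 1 -> 1 <= D ->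
      jacobi_standing a b c -> stretched_exp_bound gamma D a b c ->
      gamma = 2^-1 ->
      (N_jacobi a b c <= (expR (C * Num.sqrt D))%:E)%E)
  /\
  (forall gamma : R, 2^-1 <= gamma < 1 -> 2^-1 < gamma ->
    exists C : R,
    forall (D : R) (a b c : nat -> R[i]),
      1 <= D ->
      jacobi_standing a b c -> stretched_exp_bound gamma D a b c ->
      (N_jacobi a b c <= (C * D `^ (gamma / (2 * gamma - 1)))%:E)%E).
Proof.
split.
  have [C C0 hC] := eigenvalue_count_half R.
  exists C; split => // gamma D a b c _ D1 hst hD g2.
  by apply: hC => //; rewrite -g2.
move=> gamma /andP[_ g1] g2.
(* Decay with exponent [gamma] implies decay with any smaller positive exponent, so one in
   [(1/2, 3/5]] can be used. *)
pose g' := Order.min gamma (3 / 5).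
have g'2 : 2^-1 < g' <= 3 / 5.
  by rewrite lt_min g2 ge_min lexx orbT /= andbT; lra.
have [C C0 hC] := eigenvalue_count_gt_half g'2.
exists C => D a b c D1 hst hD.
have D0 : 0 <= D by exact: le_trans D1.
apply: le_trans (hC D a b c D1 hst _) _.
  apply: stretched_exp_bound_le hD => //; last by rewrite ge_min lexx.
  by have /andP[] := g'2; lra.
(* [gamma < 1] makes [gamma / (2 gamma - 1)] at least 1, so the linear bound in [D >= 1]
   suffices. *)
rewrite lee_fin ler_wpM2l ?(ltW C0) // -[leLHS]powRr1 // ler_powR //.
by rewrite ler_pdivlMr; lra.
Qed.
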